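(* There is an absolute constant $c>0$ such that for every finite point set $P\subset\mathbb{R}$ and every $k\in\{1,\dots,|P|\}$, the $k$-clustering computed by Ward's method on $P$ has $k$-means cost at most $c\cdot\mathrm{opt}_k(P)$.
   Context: For a finite nonempty $Q\subset\mathbb{R}$, $\mu(Q)$ is its mean and $\Delta(Q)=\sum_{q\in Q}(q-\mu(Q))^2$; for disjoint $A,B$, $D(A,B)=\Delta(A\cup B)-\Delta(A)-\Delta(B)$. $\mathrm{opt}_k(P)=\min_{C\subset\mathbb{R},|C|=k}\sum_{p\in P}\min_{c\in C}(p-c)^2$. Ward's method starts with the $|P|$ singleton clusters and repeatedly merges two current clusters $A,B$ minimizing $D(A,B)$ (ties broken arbitrarily); its $k$-clustering is the clustering after $|P|-k$ merges, and its cost is the sum of $\Delta(Q)$ over its clusters. *)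

(* Defs.v *)
From mathcomp Require Import all_boot all_order all_algebra finmap.
From mathcomp Require Import boolp classical_sets reals.
From mathcomp Require Import ring.

Set Implicit Arguments.
Unset Strict Implicit.
Unset Printing Implicit Defensive.

Import Order.TTheory GRing.Theory Num.Theory.

Local Open Scope classical_set_scope.
Local Open Scope fset_scope.
Local Open Scope ring_scope.

Definition mean (R : realType) (Q : {fset R}) : R :=
  (\sum_(q <- Q) q) / #|` Q|%:R.

Definition Delta (R : realType) (Q : {fset R}) : R :=
  \sum_(q <- Q) (q - mean Q) ^+ 2.

Definition merge_cost (R : realType) (A B : {fset R}) : R :=
  Delta (A `|` B)%fset - Delta A - Delta B.

(* The minimum of (p - c)^2 over c in C, for nonempty C. The default value of
   the iterated minimum is the squared distance to some element of C, so it
   does not change the result. *)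
Definition sqdist (R : realType) (p : R) (C : {fset R}) : R :=
  \big[Num.min/(p - head 0 C) ^+ 2]_(c <- C) (p - c) ^+ 2.

Definition center_cost (R : realType) (P C : {fset R}) : R :=
  \sum_(p <- P) sqdist p C.

(* For 0 < k <= #|P| this infimum is a minimum, see [opt_attained]. *)
Definition opt (R : realType) (k : nat) (P : {fset R}) : R :=
  inf [set center_cost P C | C in [set C : {fset R} | #|` C| = k]].

Definition singletons (R : realType) (P : {fset R}) : {fset {fset R}} :=
  [fset [fset p]%fset | p in P]%fset.

Definition ward_step (R : realType) (Cs Cs' : {fset {fset R}}) : Prop :=
  exists A B : {fset R},
    [/\ A \in Cs, B \in Cs, A != B,
        forall A' B' : {fset R}, A' \in Cs -> B' \in Cs -> A' != B' ->
          merge_cost A B <= merge_cost A' B'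
      & Cs' = ((A `|` B) |` (Cs `\ A `\ B))%fset].

(* [ward_run P n Cs]: Cs is a possible clustering after n merges starting from
   the singletons of P, for some way of breaking ties. *)
Fixpoint ward_run (R : realType) (P : {fset R}) (n : nat)
    (Cs : {fset {fset R}}) : Prop :=
  match n with
  | 0 => Cs = singletons P
  | n'.+1 => exists Cs0, ward_run P n' Cs0 /\ ward_step Cs0 Cs
  end.

Definition ward_clustering (R : realType) (k : nat) (P : {fset R})
    (Cs : {fset {fset R}}) : Prop :=
  ward_run P (#|` P| - k)%N Cs.

Definition clustering_cost (R : realType) (Cs : {fset {fset R}}) : R :=
  \sum_(Q <- Cs) Delta Q.

Lemma sqdist_le (R : realType) (p c : R) (C : {fset R}) :
  c \in C -> sqdist p C <= (p - c) ^+ 2.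
Proof. by move=> cC; apply: (bigmin_inf_seq _ c). Qed.

Lemma sqdist_witness (R : realType) (p : R) (C : {fset R}) :
  (0 < #|` C|)%N -> exists2 c, c \in C & sqdist p C = (p - c) ^+ 2.
Proof.
move=> C0; rewrite /sqdist.
have h0 : head 0 C \in C by rewrite -nth0; apply: mem_nth.
rewrite big_seq; elim/big_ind: _ => [|x y [c cC ->] [d dC ->]|c cC].
- by exists (head 0 C).
- by rewrite minElt; case: ifP => _; [exists c | exists d].
- by exists c.
Qed.

Lemma Delta_le (R : realType) (Q : {fset R}) (c : R) :
  Delta Q <= \sum_(q <- Q) (q - c) ^+ 2.
Proof.
have [->|Q0] := eqVneq Q fset0; first by rewrite /Delta !big_seq_fset0.
have n0 : (#|` Q|%:R : R) != 0 by rewrite pnatr_eq0 cardfs_eq0.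
rewrite -subr_ge0 /Delta -sumrB.
have -> : \sum_(q <- Q) ((q - c) ^+ 2 - (q - mean Q) ^+ 2) =
    #|` Q|%:R * (mean Q - c) ^+ 2.
  have sQ : \sum_(q <- Q) q = #|` Q|%:R * mean Q by rewrite /mean mulrCA divff ?mulr1.
  rewrite (eq_bigr (fun q => q * ((mean Q - c) *+ 2) + (c ^+ 2 - mean Q ^+ 2)));
    last by move=> q _; ring.
  rewrite big_split /= -mulr_suml sQ.
  rewrite big_const_seq count_predT iter_addr_0 -[X in _ + X]mulr_natl.
  ring.
by rewrite mulr_ge0 ?ler0n ?sqr_ge0.
Qed.

Lemma fset_between (T : choiceType) (A B : {fset T}) (k : nat) :
  (A `<=` B)%fset -> (#|` A| <= k)%N -> (k <= #|` B|)%N ->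
  exists C : {fset T}, [/\ (A `<=` C)%fset, (C `<=` B)%fset & #|` C| = k].
Proof.
move=> AB; elim: k => [|k IH] Ak kB.
  by exists A; split=> //; apply/eqP; rewrite -leqn0.
have [E|N] := eqVneq #|` A| k.+1; first by exists A.
have {}Ak : (#|` A| <= k)%N by rewrite -ltnS ltn_neqAle N.
have [C [AC CB Ck]] := IH Ak (ltnW kB).
have /fset0Pn[x] : (B `\` C != fset0)%fset.
  by rewrite -cardfs_gt0 cardfsDS // Ck subn_gt0.
rewrite inE => /andP[xC xB]; exists (x |` C)%fset; split.
- exact: fsubset_trans AC (fsubsetU1 _ _).
- by rewrite fsubUset fsub1set xB.
- by rewrite cardfsU1 xC Ck.
Qed.

Lemma argmin_fset (T : choiceType) (R : realType) (f : T -> R) (S : {fset T}) :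
  (S != fset0)%fset ->
  exists2 x, x \in S & forall y, y \in S -> f x <= f y.
Proof.
case/fset0Pn=> x0 x0S.
case: (arg_minP (fun i : S => f (val i)) (i0 := [`x0S]%fset) (P := predT)) => //.
move=> i _ H; exists (val i); first exact: valP.
by move=> y yS; apply: (H [`yS]%fset).
Qed.

Lemma opt_attained (R : realType) (k : nat) (P : {fset R}) :
  (0 < k)%N -> (k <= #|` P|)%N ->
  exists C : {fset R},
    [/\ #|` C| = k, opt k P = center_cost P C
      & forall C' : {fset R}, #|` C'| = k -> center_cost P C <= center_cost P C'].
Proof.
move=> k0 kP.
pose S := (P `|` [fset mean Q | Q in fpowerset P])%fset.
have kS : (k <= #|` S|)%N.
  by rewrite (leq_trans kP) // fsubset_leq_card // fsubsetUl.
have key (C : {fset R}) : #|` C| = k -> exists C' : {fset R},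
    [/\ (C' `<=` S)%fset, #|` C'| = k & center_cost P C' <= center_cost P C].
  move=> Ck.
  have C0 : (0 < #|` C|)%N by rewrite Ck.
  have /choice[f fP] : forall p : R, exists c,
      c \in C /\ sqdist p C = (p - c) ^+ 2.
    by move=> p; have [c ? ?] := sqdist_witness p C0; exists c.
  pose cl c := [fset p in P | f p == c]%fset.
  pose M := [fset mean (cl c) | c in C]%fset.
  have MS : (M `<=` S)%fset.
    apply/fsubsetP => x /imfsetP[c /= cC ->].
    rewrite inE; apply/orP; right; apply/imfsetP; exists (cl c) => //=.
    rewrite fpowersetE; apply/fsubsetP => p; by rewrite !inE => /andP[].
  have Mk : (#|` M| <= k)%N by rewrite -Ck leq_imfset_card.
  have [C' [MC' C'S C'k]] := fset_between MS Mk kS.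
  exists C'; split=> //.
  have part (F : R -> R -> R) : \sum_(p <- P) F p (f p) =
      \sum_(c <- C) \sum_(p <- cl c) F p c.
    rewrite [RHS](eq_bigr (fun c => \sum_(p <- P | f p == c) F p c)); last first.
      by move=> c _; rewrite [RHS]big_fset_condE.
    rewrite (exchange_big_dep predT) //=; apply: eq_bigr => p _.
    have [fpC _] := fP p.
    rewrite (big_rem (f p)) //= eqxx big1_seq ?addr0 //.
    by move=> c /andP[/eqP <-]; rewrite mem_rem_uniq ?fset_uniq // inE eqxx.
  rewrite /center_cost.
  rewrite [leRHS](eq_bigr (fun p => (p - f p) ^+ 2)); last first.
    by move=> p _; have [] := fP p.
  apply: (@le_trans _ _ (\sum_(p <- P) (p - mean (cl (f p))) ^+ 2)).
    apply: ler_sum => p _; apply: sqdist_le; apply: (fsubsetP MC').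
    by apply/imfsetP; exists (f p) => //=; have [] := fP p.
  rewrite (part (fun p c => (p - mean (cl c)) ^+ 2)).
  rewrite (part (fun p c => (p - c) ^+ 2)).
  by apply: ler_sum => c _; apply: Delta_le.
pose K := [fset C in fpowerset S | #|` C| == k]%fset.
have [C1 [_ C1S C1k]] := fset_between (fsub0set S) (leq0n k : (#|` fset0 : {fset R}| <= k)%N) kS.
have K0 : (K != fset0)%fset.
  by apply/fset0Pn; exists C1; rewrite !inE fpowersetE C1S C1k /=.
have [C CK Cmin] := argmin_fset (center_cost P) K0.
have Ck : #|` C| = k by move: CK; rewrite !inE => /andP[_ /eqP].
have Cle (C' : {fset R}) : #|` C'| = k -> center_cost P C <= center_cost P C'.
  move=> /key[C2 [C2S C2k]]; apply: le_trans; apply: Cmin.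
  by rewrite !inE fpowersetE C2S C2k /=.
exists C; split=> //; apply/le_anti/andP; split.
- apply: ge_inf; last by exists C.
  by exists (center_cost P C) => _ [C' /= C'k <-]; apply: Cle.
- apply: lb_le_inf; first by exists (center_cost P C), C.
  by move=> _ [C' /= C'k <-]; apply: Cle.
Qed.

(* Main.v *)
Require Import Defs.
From mathcomp Require Import all_boot all_order all_algebra finmap.
From mathcomp Require Import boolp reals ring lra zify.

Set Implicit Arguments.
Unset Strict Implicit.
Unset Printing Implicit Defensive.

Import Order.TTheory GRing.Theory Num.Theory.

Local Open Scope fset_scope.
Local Open Scope ring_scope.

(** Fix an optimal [k]-clustering with reference clusters [O_0 < O_1 < ...] and
cost [W]. On the line every Ward cluster is convex in [P], because merging two
clusters across a third one is never optimal; and by the Lance-Williams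
recurrence the cost [d] of the cheapest merge never decreases.

Clusters are live or dead. A live one meets at most two consecutive reference
clusters and has its home in the one containing its majority. Its weight
[4 w + 4 psi], where [w] is its cost with respect to the reference centers and [psi] the part
of [Delta] due to meeting several reference clusters, bounds its distance to the
home center, so any two live clusters of the same home satisfy
[d <= weight + weight].

The surplus counts the live clusters beyond the first of each home. A merge of
cost [d] raises [sum psi] by at most [d]. If it keeps the surplus, a counter [b] is
increased and the cost is charged to [b * d]; otherwise the surplus drops by one
and a potential pays. When the result is dead, the total weight of some home, its
lightest cluster excepted, drops by [d / 2]. When it is live and straddles two
reference clusters, it has absorbed an inner one, that is, one contained in a
single reference cluster. Either another inner cluster remains there, and the
same argument applied to inner clusters only pays; or none remains, and then the
weight multipliers of the straddling clusters there drop by a factor 16.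
As Ward never has fewer than [k] clusters, [b] is at most the surplus, hence
[b * d] is at most the potential, and [sum psi = O(W)]. *)

(** * Weighted sets and their weight beyond the lightest element *)

Section WeightedSets.
Variables (R : realFieldType) (T : choiceType) (g : T -> R).
Hypothesis g_ge0 : forall X, 0 <= g X.

Definition wsum (S : {fset T}) : R := \sum_(X <- S) g X.

(* The total weight of [S] without its lightest element. *)
Definition excess (S : {fset T}) : R :=
  \big[Num.max/0]_(X <- S) (wsum S - g X).

Definition pair_bound (d : R) (S : {fset T}) : Prop :=
  forall X Y, X \in S -> Y \in S -> X != Y -> d <= g X + g Y.

Lemma wsumD1 A S : A \in S -> wsum S = g A + wsum (S `\ A).
Proof. by move=> AS; rewrite /wsum (big_fsetD1 A). Qed.

Lemma wsumU1 A S : A \notin S -> wsum (A |` S) = g A + wsum S.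
Proof. by move=> AS; rewrite /wsum big_fsetU1. Qed.

Lemma wsum_ge0 S : 0 <= wsum S.
Proof. by apply: sumr_ge0. Qed.

Lemma wsum_ge A S : A \in S -> g A <= wsum S.
Proof. by move=> AS; rewrite (wsumD1 AS) lerDl wsum_ge0. Qed.

Lemma wsum_ge2 A B S : A \in S -> B \in S -> A != B -> g A + g B <= wsum S.
Proof.
move=> AS BS AB; rewrite (wsumD1 AS) lerD2l wsum_ge // in_fsetD1 BS andbT.
by rewrite eq_sym.
Qed.

Lemma excess_ge0 S : 0 <= excess S.
Proof. exact: bigmax_ge_id. Qed.

Lemma excess_ge A S : A \in S -> wsum S - g A <= excess S.
Proof.
move=> AS; rewrite /excess.
exact: (@le_bigmax_seq _ _ _ _ _ A predT (fun X => wsum S - g X) AS).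
Qed.

Lemma excess_le S c :
  0 <= c -> (forall A, A \in S -> wsum S - g A <= c) -> excess S <= c.
Proof.
by move=> c0 H; rewrite /excess big_seq; elim/big_ind: _ => [|x y xc yc|A /H]; rewrite ?ge_max ?xc.
Qed.

Lemma card_ge2_other A (S : {fset T}) :
  A \in S -> (1 < #|` S|)%N -> exists2 B, B \in S & B != A.
Proof.
move=> AS; rewrite (cardfsD1 A) AS /= add1n ltnS cardfs_gt0 => /fset0Pn[B].
by rewrite in_fsetD1 => /andP[BA BS]; exists B.
Qed.

Lemma excessD1 A S :
  A \in S -> (1 < #|` S|)%N -> excess (S `\ A) + g A <= excess S.
Proof.
move=> AS S2; have [B BS BA] := card_ge2_other AS S2.
rewrite -lerBrDr; apply: excess_le => [|Z].
  by have := excess_ge BS; have := wsum_ge2 AS BS; rewrite eq_sym BA => /(_ isT); lra.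
rewrite in_fsetD1 => /andP[ZA ZS]; have := excess_ge ZS.
by rewrite (wsumD1 AS); lra.
Qed.

(** For a remaining [Z], averaging the lower bounds of [excess S] that omit [A] and [Z] gives a drop
    of at least [(g A + g Z) / 2]. This works even when [A] is the lightest element. *)
Lemma excessD1_half d A S :
  pair_bound d S -> A \in S -> (1 < #|` S|)%N ->
  excess (S `\ A) + d / 2 <= excess S.
Proof.
move=> dS AS S2; have [B BS BA] := card_ge2_other AS S2.
have key Z : Z \in S -> Z != A -> d <= g Z + g A by move=> *; apply: dS.
rewrite -lerBrDr; apply: excess_le => [|Z].
  have := wsum_ge2 BS AS BA; have := excess_ge BS; have := excess_ge AS.
  by have := key _ BS BA; lra.
rewrite in_fsetD1 => /andP[ZA ZS]; have := excess_ge ZS; have := excess_ge AS.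
have := key _ ZS ZA; rewrite (wsumD1 AS); lra.
Qed.

(** Remove the elements one at a time; each removal but the last frees [d / 2]. *)
Lemma excess_card d S :
  0 <= d -> pair_bound d S -> (#|` S|.-1)%:R * (d / 2) <= excess S.
Proof.
move=> d0; move E: #|` S| => n; elim: n S E => [|n IH] S E dS.
  by rewrite mul0r excess_ge0.
have [n0|n0] := posnP n; first by rewrite n0 mul0r excess_ge0.
have [A AS] : exists A, A \in S by apply/fset0Pn; rewrite -cardfs_gt0 E.
have S2 : (1 < #|` S|)%N by rewrite E ltnS.
apply: le_trans (excessD1_half dS AS S2).
have /IH : #|` S `\ A| = n by move: E; rewrite (cardfsD1 A) AS add1n => -[].
move=> /(_ _); have dS' : pair_bound d (S `\ A).
  by move=> X Y; rewrite !in_fsetD1 => /andP[_ ?] /andP[_ ?]; apply: dS.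
move=> /(_ dS'); rewrite -{2}(prednK n0) /= -natr1; lra.
Qed.

Lemma excess_merge e A B C S :
  0 <= e -> A \in S -> B \in S -> A != B -> C \notin S ->
  g C <= g A + g B + e ->
  excess (C |` (S `\ A `\ B)) <= excess S + e.
Proof.
move=> e0 AS BS AB CS gC.
have CS' : C \notin S `\ A `\ B by rewrite !in_fsetD1 (negPf CS) !andbF.
have BSA : B \in S `\ A by rewrite in_fsetD1 BS andbT eq_sym.
have SE := wsumD1 AS; rewrite (wsumD1 BSA) in SE.
have ex0 := excess_ge0 S.
apply: excess_le => [|Z]; first by lra.
rewrite (wsumU1 CS') in_fset1U => /orP[/eqP->|].
  by have := excess_ge AS; have := g_ge0 B; lra.
by rewrite !in_fsetD1 => /and3P[_ _ /excess_ge]; lra.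
Qed.

(** For [A] lying in another fiber: [C] takes the place of [B], and the whole weight of [A] is new
    to [S]. *)
Lemma excess_replace e A B C S :
  0 <= g A + e -> B \in S -> C \notin S ->
  g C <= g A + g B + e ->
  excess (C |` (S `\ B)) <= excess S + g A + e.
Proof.
move=> e0 BS CS gC.
have CS' : C \notin S `\ B by rewrite !in_fsetD1 (negPf CS) !andbF.
have SE := wsumD1 BS; have ex0 := excess_ge0 S.
apply: excess_le => [|Z]; first by lra.
rewrite (wsumU1 CS') in_fset1U => /orP[/eqP->|].
  by have := excess_ge BS; lra.
by rewrite !in_fsetD1 => /andP[_ /excess_ge]; lra.
Qed.

End WeightedSets.

(** * Surplus and excess of a family split into fibers *)

Section Keyed.
Variables (R : realFieldType) (T : choiceType) (g : T -> R) (K : nat).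
Hypothesis g_ge0 : forall X, 0 <= g X.
Variable key : T -> nat.

Definition fiber (L : {fset T}) (i : nat) : {fset T} := [fset X in L | key X == i].

Definition surplus (L : {fset T}) : nat := \sum_(i < K) #|` fiber L i|.-1.

Definition total_excess (L : {fset T}) : R := \sum_(i < K) excess g (fiber L i).

Lemma in_fiber L i X : (X \in fiber L i) = (X \in L) && (key X == i).
Proof. by rewrite !inE. Qed.

Lemma fiberD1 L A i : fiber (L `\ A) i = fiber L i `\ A.
Proof. by apply/fsetP => X; rewrite !(in_fiber, in_fsetD1) andbA. Qed.

Lemma fiberD1_id L A i : key A != i -> fiber L i `\ A = fiber L i.
Proof.
move=> Ai; apply/fsetP => X; rewrite !(in_fiber, in_fsetD1).
by case: eqVneq => //= ->; rewrite (negPf Ai) andbF.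
Qed.

Lemma fiberU1 L C i :
  fiber (C |` L) i = if key C == i then C |` fiber L i else fiber L i.
Proof.
apply/fsetP => X; rewrite !(in_fiber, in_fset1U); case: ifP => Ci;
  rewrite ?(in_fiber, in_fset1U); case: (eqVneq X C) => //= ->; rewrite Ci //.
by rewrite andbF.
Qed.

Lemma sum_fibers (V : nmodType) (F : T -> V) (L : {fset T}) :
  (forall X, X \in L -> (key X < K)%N) ->
  \sum_(X <- L) F X = \sum_(i < K) \sum_(X <- fiber L i) F X.
Proof.
move=> kL; rewrite (eq_bigr (fun i : 'I_K => \sum_(X <- L | key X == i) F X)); last first.
  by move=> i _; rewrite [RHS]big_fset_condE.
rewrite (exchange_big_dep predT) //= big_seq [RHS]big_seq; apply: eq_bigr => X XL.
rewrite (bigD1 (Ordinal (kL X XL))) //= big1 ?addr0 // => i /andP[/eqP Xi].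
by rewrite -val_eqE /= -Xi eqxx.
Qed.

Lemma total_excess_ge0 L : 0 <= total_excess L.
Proof. by apply: sumr_ge0 => i _; apply: excess_ge0. Qed.

Lemma sum_at (V : nmodType) (j : nat) (x : V) :
  (j < K)%N -> \sum_(i < K) (if j == i then x else 0) = x.
Proof.
move=> jK; rewrite (bigD1 (Ordinal jK)) //= eqxx big1 ?addr0 // => i.
by rewrite -val_eqE /= eq_sym => /negPf->.
Qed.

(** Converts the charge [b * d] into potential once [b] is at most the surplus. *)
Lemma surplus_card d L :
  0 <= d -> (forall i, pair_bound g d (fiber L i)) ->
  (surplus L)%:R * d <= 2 * total_excess L.
Proof.
move=> d0 dL; rewrite /surplus /total_excess natr_sum mulr_suml mulr_sumr.
apply: ler_sum => i _; have := excess_card g_ge0 d0 (dL i).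
lra.
Qed.

Lemma total_excessD1_half d L A :
  0 <= d -> (forall i, pair_bound g d (fiber L i)) -> A \in L -> (key A < K)%N ->
  (1 < #|` fiber L (key A)|)%N ->
  total_excess (L `\ A) + d / 2 <= total_excess L.
Proof.
move=> d0 dL AL AK r2; rewrite -{1}(sum_at (d / 2) AK) -big_split /=.
apply: ler_sum => i _; rewrite fiberD1; case: eqVneq => [<-|ne].
  by apply: (excessD1_half g_ge0 (dL _)) => //; rewrite in_fiber AL eqxx.
by rewrite fiberD1_id // addr0.
Qed.

Lemma excess_sub S S' : S' `<=` S -> excess g S' <= excess g S.
Proof.
move=> SS; apply: excess_le => [|A AS]; first exact: excess_ge0.
apply: le_trans (excess_ge _ (fsubsetP SS _ AS)); rewrite lerD2r /wsum.
rewrite [leRHS](big_fsetID _ (mem S')) /=.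
have -> : [fset X in S | X \in S'] = S'.
  by apply/fsetP=> X; rewrite !inE; case XS: (X \in S'); rewrite ?andbF ?andbT ?(fsubsetP SS).
by rewrite lerDl sumr_ge0.
Qed.

Lemma fiber_sub L L' i : L' `<=` L -> fiber L' i `<=` fiber L i.
Proof.
by move=> LL; apply/fsubsetP => X; rewrite !in_fiber => /andP[/(fsubsetP LL)-> ->].
Qed.

Lemma total_excess_sub L L' : L' `<=` L -> total_excess L' <= total_excess L.
Proof. by move=> LL; apply: ler_sum => i _; apply/excess_sub/fiber_sub. Qed.

Lemma surplusD1 L A : A \in L -> (key A < K)%N ->
  surplus L = (surplus (L `\ A) + (1 < #|` fiber L (key A)|))%N.
Proof.
move=> AL AK; set c := nat_of_bool _.
have -> : c = \sum_(i < K) (if key A == i then c else 0)%N by rewrite (@sum_at nat).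
rewrite -big_split /=; apply: eq_bigr => i _; rewrite fiberD1.
case: eqVneq => [<-|ne]; last by rewrite fiberD1_id // addn0.
have E : #|` fiber L (key A)| = #|` fiber L (key A) `\ A|.+1.
  by rewrite (cardfsD1 A) in_fiber AL eqxx.
by rewrite /c E /=; case: #|` _| => //= n; rewrite addn1.
Qed.

(* [C] takes over the fiber of [B]; when it leaves the fiber of [A], the excess
   [g A] freed there pays for the part of [g C] that comes from [A]. *)
Lemma keyed_merge e L A B C :
  0 <= e -> A \in L -> B \in L -> A != B -> C \notin L ->
  (key A < K)%N -> (key B < K)%N -> key C = key B ->
  (key A != key B -> (1 < #|` fiber L (key A)|)%N) ->
  g C <= g A + g B + e ->
  total_excess (C |` (L `\ A `\ B)) <= total_excess L + e /\
  (surplus L <= (surplus (C |` (L `\ A `\ B))).+1)%N.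
Proof.
move=> e0 AL BL AB CL AK BK CB rA gC.
have inf X : X \in L -> X \in fiber L (key X) by move=> XL; rewrite in_fiber XL eqxx.
have CF i : C \notin fiber L i by rewrite in_fiber (negPf CL).
have CL' : C \notin L `\ A `\ B by rewrite !in_fsetD1 (negPf CL) !andbF.
have BLA : B \in L `\ A by rewrite in_fsetD1 eq_sym AB.
split; last first.
  rewrite (surplusD1 AL AK) (surplusD1 BLA BK).
  have CU : C \in C |` (L `\ A `\ B) by rewrite in_fset1U eqxx.
  have := surplusD1 CU; rewrite CB fsetU1K // => -> //.
  rewrite fiberU1 CB eqxx.
  (* Exchanging [B] for [C] preserves the size of the fiber, so only the removal of [A] can lower
     the surplus. *)
  have c3 : #|` C |` fiber (L `\ A `\ B) (key B)| = #|` fiber (L `\ A) (key B)|.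
    rewrite fiberD1 cardfsU1 in_fsetD1 in_fiber in_fsetD1 (negPf CL) !andbF /=.
    by rewrite [RHS](cardfsD1 B) in_fiber BLA eqxx.
  rewrite c3; lia.
have [E|N] := eqVneq (key A) (key B).
  rewrite -(sum_at e AK) -big_split /=; apply: ler_sum => i _.
  rewrite fiberU1 !fiberD1 CB -E; case: eqVneq => [<-|ne].
    by apply: excess_merge => //; rewrite ?inf // E inf.
  by rewrite addr0 !fiberD1_id // ?E -?E.
have eqs : e = \sum_(i < K) ((if key A == i then - g A else 0) + (if key B == i then g A + e else 0)).
  by rewrite big_split /= !sum_at //; lra.
rewrite [X in _ <= _ + X]eqs -big_split /=; apply: ler_sum => i _.
rewrite fiberU1 !fiberD1 CB; case: (eqVneq (key B) i) => [Bi|Bi].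
  rewrite (fiberD1_id L (A := A)) -?Bi // (negPf N).
  have := @excess_replace _ _ g e A B C (fiber L (key B)).
  rewrite (inf _ BL) CF => /(_ _ isT isT gC); have := g_ge0 A; lra.
rewrite (_ : fiber L i `\ A `\ B = fiber L i `\ A); last first.
  by apply/fsetP=> X; rewrite in_fsetD1; case: (eqVneq X B) => //= ->; rewrite in_fsetD1 in_fiber (negPf Bi) !andbF.
case: eqVneq => [Ai|Ai]; last by rewrite fiberD1_id // !addr0.
have := @excessD1 _ _ g g_ge0 A (fiber L i); rewrite -Ai inf // => /(_ isT (rA N)); lra.
Qed.

End Keyed.

(** * Ward's merge cost *)

Section MergeCost.
Variable R : realType.
Implicit Types (A B C Q : {fset R}) (c d : R).

Lemma sum_fsetU (T : choiceType) (V : nmodType) (F : T -> V) (A B : {fset T}) :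
  [disjoint A & B] ->
  \sum_(x <- A `|` B) F x = \sum_(x <- A) F x + \sum_(x <- B) F x.
Proof.
move=> dAB; rewrite (big_fsetID _ (mem A)) /=; congr (_ + _); apply: eq_fbigl => x.
  by rewrite !inE /=; case: (x \in A); rewrite ?andbF ?orbF.
rewrite !inE /=; case xA: (x \in A) => /=; last by rewrite ?andbT.
by rewrite ?andbF; apply/esym/negbTE/(fdisjointP dAB).
Qed.

Lemma cardfsU_disjoint (T : choiceType) (A B : {fset T}) :
  [disjoint A & B] -> #|` A `|` B| = (#|` A| + #|` B|)%N.
Proof.
by move=> /eqP dAB; have := cardfsUI A B; rewrite dAB cardfs0 addn0.
Qed.

Lemma card_gt0R Q : Q != fset0 -> 0 < #|` Q|%:R :> R.
Proof. by rewrite ltr0n cardfs_gt0. Qed.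

Lemma sum_fset_const Q c : \sum_(q <- Q) c = #|` Q|%:R * c.
Proof. by rewrite big_const_seq count_predT iter_addr_0 mulr_natl. Qed.

Lemma sum_mean Q : \sum_(q <- Q) q = #|` Q|%:R * mean Q.
Proof.
have [->|Q0] := eqVneq Q fset0; first by rewrite big_seq_fset0 cardfs0 mul0r.
by rewrite /mean mulrC divfK // gt_eqF ?card_gt0R.
Qed.

(** The parallel axis identity. *)
Lemma sumsq_shift Q c :
  \sum_(q <- Q) (q - c) ^+ 2 = Delta Q + #|` Q|%:R * (mean Q - c) ^+ 2.
Proof.
have key a : \sum_(q <- Q) (q - a) ^+ 2 =
    \sum_(q <- Q) q ^+ 2 - 2 * a * (#|` Q|%:R * mean Q) + #|` Q|%:R * a ^+ 2.
  rewrite -sum_mean -sum_fset_const mulr_sumr -sumrB -big_split.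
  by apply: eq_bigr => q _ /=; ring.
by rewrite /Delta !key; ring.
Qed.

Lemma Delta_ge0 Q : 0 <= Delta Q.
Proof. by apply: sumr_ge0 => q _; apply: sqr_ge0. Qed.

Lemma merge_cost_le A B c : [disjoint A & B] ->
  merge_cost A B <=
    #|` A|%:R * (mean A - c) ^+ 2 + #|` B|%:R * (mean B - c) ^+ 2.
Proof.
move=> dAB; have := Delta_le (A `|` B) c.
rewrite sum_fsetU // !sumsq_shift /merge_cost; lra.
Qed.

Lemma merge_costE A B : A != fset0 -> B != fset0 -> [disjoint A & B] ->
  merge_cost A B =
    #|` A|%:R * #|` B|%:R / (#|` A|%:R + #|` B|%:R) * (mean A - mean B) ^+ 2.
Proof.
move=> A0 B0 dAB; have a0 := card_gt0R A0; have b0 := card_gt0R B0.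
have E : mean (A `|` B) =
    (#|` A|%:R * mean A + #|` B|%:R * mean B) / (#|` A|%:R + #|` B|%:R).
  by rewrite {1}/mean sum_fsetU // !sum_mean cardfsU_disjoint // natrD.
rewrite /merge_cost {1}/Delta sum_fsetU // !sumsq_shift E.
by field; rewrite gt_eqF ?addr_gt0.
Qed.

Lemma merge_cost_ge0 A B : [disjoint A & B] -> 0 <= merge_cost A B.
Proof.
move=> dAB; rewrite /merge_cost {1}/Delta sum_fsetU // !sumsq_shift.
have := mulr_ge0 (ler0n R #|` A|) (sqr_ge0 (mean A - mean (A `|` B))).
have := mulr_ge0 (ler0n R #|` B|) (sqr_ge0 (mean B - mean (A `|` B))); lra.
Qed.

Lemma merge_costC A B : merge_cost A B = merge_cost B A.
Proof. by rewrite /merge_cost fsetUC; lra. Qed.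

(** The recurrence writes the cost of joining [C] to the union as a combination of the three old
    costs with coefficients summing to 1, the only negative one being that of [merge_cost A B]
    itself. *)
Lemma merge_cost_reducible A B C :
  A != fset0 -> B != fset0 -> C != fset0 ->
  [disjoint A & B] -> [disjoint A & C] -> [disjoint B & C] ->
  merge_cost A B <= merge_cost A C -> merge_cost A B <= merge_cost B C ->
  merge_cost A B <= merge_cost (A `|` B) C.
Proof.
move=> A0 B0 C0 dAB dAC dBC.
have dUC : [disjoint A `|` B & C] by rewrite fdisjointUX dAC.
have U0 : A `|` B != fset0.
  by case/fset0Pn: A0 => x xA; apply/fset0Pn; exists x; rewrite inE xA.
have a0 := card_gt0R A0; have b0 := card_gt0R B0; have c0 := card_gt0R C0.
(* Lance-Williams recurrence *)
have LW : (#|` A|%:R + #|` B|%:R + #|` C|%:R) * merge_cost (A `|` B) C =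
    (#|` A|%:R + #|` C|%:R) * merge_cost A C
    + (#|` B|%:R + #|` C|%:R) * merge_cost B C - #|` C|%:R * merge_cost A B.
  have E : mean (A `|` B) =
      (#|` A|%:R * mean A + #|` B|%:R * mean B) / (#|` A|%:R + #|` B|%:R).
    by rewrite {1}/mean sum_fsetU // !sum_mean cardfsU_disjoint // natrD.
  rewrite !merge_costE // cardfsU_disjoint // natrD E.
  by field; rewrite !gt_eqF ?addr_gt0.
move=> h1 h2; have s0 := addr_gt0 (addr_gt0 a0 b0) c0.
rewrite -(ler_pM2l s0) LW.
have := ler_wpM2l (ltW (addr_gt0 a0 c0)) h1.
have := ler_wpM2l (ltW (addr_gt0 b0 c0)) h2; lra.
Qed.

(* Skipping over a cluster is never optimal: from
   [a b / (a + b) (u + v)^2 < a u^2] and [... < b v^2] one gets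
   [(u + v)^2 < u^2 + v^2]. *)
Lemma merge_cost_between A B M :
  A != fset0 -> B != fset0 -> M != fset0 ->
  [disjoint A & B] -> [disjoint A & M] -> [disjoint M & B] ->
  mean A < mean M -> mean M < mean B ->
  merge_cost A B <= merge_cost A M -> merge_cost A B <= merge_cost M B -> False.
Proof.
move=> A0 B0 M0 dAB dAM dMB AM MB; rewrite !merge_costE //.
move: (card_gt0R A0) (card_gt0R B0) (card_gt0R M0).
move: #|` A|%:R #|` B|%:R #|` M|%:R => a b m a0 b0 m0.
set u := mean M - mean A; set v := mean B - mean M.
have u0 : 0 < u by rewrite subr_gt0.
have v0 : 0 < v by rewrite subr_gt0.
have -> : mean A - mean B = - (u + v) by rewrite /u /v; ring.
have -> : mean A - mean M = - u by rewrite /u; ring.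
have -> : mean M - mean B = - v by rewrite /v; ring.
rewrite !sqrrN => h1 h2.
have ab0 : 0 < a + b by apply: addr_gt0.
have am0 : 0 < a + m by apply: addr_gt0.
have mb0 : 0 < m + b by apply: addr_gt0.
(* The size of [M] disappears because [a * m / (a + m) <= a]. *)
have h1' : a * b / (a + b) * (u + v) ^+ 2 <= a * u ^+ 2.
  apply: le_trans h1 _; apply: ler_wpM2r; first exact: sqr_ge0.
  by rewrite ler_pdivrMr // ler_pM2l // lerDr ltW.
have h2' : a * b / (a + b) * (u + v) ^+ 2 <= b * v ^+ 2.
  apply: le_trans h2 _; apply: ler_wpM2r; first exact: sqr_ge0.
  by rewrite ler_pdivrMr // mulrC ler_pM2l // lerDl ltW.
have E : (a + b) * (a * b / (a + b) * (u + v) ^+ 2) = a * b * (u + v) ^+ 2.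
  by field; rewrite gt_eqF.
have {}h1' : b * (u + v) ^+ 2 <= (a + b) * u ^+ 2.
  by rewrite -(ler_pM2l a0) mulrA -E [leRHS]mulrCA ler_pM2l.
have {}h2' : a * (u + v) ^+ 2 <= (a + b) * v ^+ 2.
  by rewrite -(ler_pM2l b0) mulrA [b * a]mulrC -E [leRHS]mulrCA ler_pM2l.
have : (a + b) * (u + v) ^+ 2 <= (a + b) * (u ^+ 2 + v ^+ 2) by lra.
rewrite ler_pM2l // => h; have := mulr_gt0 u0 v0; nra.
Qed.

Lemma mean_lt A B : A != fset0 -> B != fset0 ->
  (forall x y, x \in A -> y \in B -> x < y) -> mean A < mean B.
Proof.
move=> A0 B0 lt; have a0 := card_gt0R A0; have b0 := card_gt0R B0.
have [p pA pmax] : exists2 p, p \in A & forall x, x \in A -> x <= p.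
  have [p pA H] := argmin_fset (fun x : R => - x) A0.
  by exists p => // x xA; have := H x xA; rewrite lerN2.
have mA : mean A <= p.
  rewrite /mean ler_pdivrMr // mulrC -sum_fset_const big_seq [leRHS]big_seq.
  by apply: ler_sum => x xA; apply: pmax.
have [q qB qmin] := argmin_fset (@id R) B0.
have mB : q <= mean B.
  rewrite /mean ler_pdivlMr // mulrC -sum_fset_const big_seq [leRHS]big_seq.
  by apply: ler_sum => x xA; apply: qmin.
by apply: le_lt_trans mA (lt_le_trans (lt _ _ pA qB) mB).
Qed.

End MergeCost.

(** * Reference clusters, spread, weight and home *)

Section Pieces.
Variables (R : realType) (f : R -> nat) (ctr : nat -> R) (K : nat).
Hypothesis f_lt : forall p, (f p < K)%N.
Implicit Types (A B X : {fset R}).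

Definition refcost A : R := \sum_(p <- A) (p - ctr (f p)) ^+ 2.

Definition piece A (i : nat) : {fset R} := [fset p in A | f p == i].

(* The part of [Delta A] caused by [A] meeting several reference clusters. *)
Definition spread A : R := Delta A - \sum_(i < K) Delta (piece A i).

Definition weight A : R := 4 * refcost A + 4 * spread A.

(** The default [K] exceeds every value of [f], so on a nonempty cluster this is the first reference
    cluster met. *)
Definition lo A : nat := \big[minn/K]_(p <- A) f p.

Definition inner A : bool := all (fun p => f p == lo A) A.

Definition narrow A : bool := all (fun p => f p <= (lo A).+1)%N A.

(* For a narrow cluster, the reference cluster containing at least half of it. *)
Definition home A : nat :=
  if (#|` A| <= 2 * #|` piece A (lo A)|)%N then lo A else (lo A).+1.

Lemma in_piece A i p : (p \in piece A i) = (p \in A) && (f p == i).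
Proof. by rewrite !inE. Qed.

Lemma lo_le A p : p \in A -> (lo A <= f p)%N.
Proof.
rewrite /lo => pA; have {pA} : p \in enum_fset A := pA.
elim: (enum_fset A) => // q s IH; rewrite inE big_cons => /orP[/eqP<-|/IH h].
  exact: geq_minl.
exact: leq_trans (geq_minr _ _) h.
Qed.

Lemma lo_attained A : A != fset0 -> exists2 p, p \in A & f p = lo A.
Proof.
case/fset0Pn => x xA; suff: exists2 p, p \in enum_fset A & f p = lo A by [].
have {xA} : enum_fset A != [::] by apply: contraTneq xA => A0; rewrite -[x \in A]/(x \in enum_fset A) A0.
rewrite /lo; elim: (enum_fset A) => // q s IH _; rewrite big_cons.
case: s IH => [|r s] IH.
  by rewrite big_nil; exists q; rewrite ?inE // (minn_idPl (ltnW (f_lt q))).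
have [|p ps E] := IH _; first by [].
rewrite -E; case: (leqP (f q) (f p)) => _; [exists q | exists p] => //.
  by rewrite inE eqxx.
by rewrite inE ps orbT.
Qed.

Lemma lo_lt A : A != fset0 -> (lo A < K)%N.
Proof. by case/lo_attained => p _ <-. Qed.

Lemma sum_pieces (V : nmodType) (F : R -> V) A :
  \sum_(p <- A) F p = \sum_(i < K) \sum_(p <- piece A i) F p.
Proof. by apply: sum_fibers. Qed.

(** The between-group term in the decomposition of variance. *)
Lemma spreadE A :
  spread A = \sum_(i < K) #|` piece A i|%:R * (mean (piece A i) - mean A) ^+ 2.
Proof.
rewrite /spread {1}/Delta sum_pieces -sumrB; apply: eq_bigr => i _.
by rewrite sumsq_shift; ring.
Qed.

Lemma spread_ge0 A : 0 <= spread A.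
Proof.
by rewrite spreadE; apply: sumr_ge0 => i _; rewrite mulr_ge0 ?ler0n ?sqr_ge0.
Qed.

Lemma refcost_ge0 A : 0 <= refcost A.
Proof. by apply: sumr_ge0 => p _; apply: sqr_ge0. Qed.

Lemma weight_ge0 A : 0 <= weight A.
Proof. by have := refcost_ge0 A; have := spread_ge0 A; rewrite /weight; lra. Qed.

Lemma refcost_sub A B : A `<=` B -> refcost A <= refcost B.
Proof.
move=> AB; rewrite /refcost [leRHS](big_fsetID _ (mem A)) /=.
have -> : [fset p in B | p \in A] = A.
  by apply/fsetP=> p; rewrite !inE; case pA: (p \in A); rewrite ?andbF ?andbT ?(fsubsetP AB).
by rewrite lerDl sumr_ge0 // => p _; apply: sqr_ge0.
Qed.

Lemma refcostU A B : [disjoint A & B] -> refcost (A `|` B) = refcost A + refcost B.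
Proof. by move=> dAB; rewrite /refcost sum_fsetU. Qed.

Lemma pieceU A B i : piece (A `|` B) i = piece A i `|` piece B i.
Proof. by apply/fsetP => p; rewrite !(in_piece, in_fsetU) andb_orl. Qed.

Lemma piece_sub A i : piece A i `<=` A.
Proof. by apply/fsubsetP => p; rewrite in_piece => /andP[]. Qed.

Lemma piece_disjoint A B i : [disjoint A & B] -> [disjoint piece A i & piece B i].
Proof.
move=> /fdisjointP dAB; apply/fdisjointP => p; rewrite !in_piece => /andP[pA _].
by rewrite (negPf (dAB _ pA)).
Qed.

(** Inside each reference cluster the pieces are merged too, at nonnegative cost, and this can only
    lower the spread of the union. *)
Lemma spreadU A B : [disjoint A & B] ->
  spread (A `|` B) <= spread A + spread B + merge_cost A B.
Proof.
move=> dAB; rewrite /spread /merge_cost.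
have : \sum_(i < K) Delta (piece A i) + \sum_(i < K) Delta (piece B i) <=
       \sum_(i < K) Delta (piece (A `|` B) i).
  rewrite -big_split; apply: ler_sum => i _; rewrite pieceU.
  by have := merge_cost_ge0 (piece_disjoint i dAB); rewrite /merge_cost /=; lra.
lra.
Qed.

Lemma weightU A B : [disjoint A & B] ->
  weight (A `|` B) <= weight A + weight B + 4 * merge_cost A B.
Proof.
by move=> dAB; have := spreadU dAB; rewrite /weight refcostU //; lra.
Qed.

Lemma Delta_le_spread A : Delta A <= spread A + refcost A.
Proof.
rewrite /spread /refcost sum_pieces -lerBlDl opprB addrC addrNK.
apply: ler_sum => i _; apply: le_trans (Delta_le _ (ctr i)) _.
rewrite big_seq [leRHS]big_seq le_eqVlt; apply/orP; left; apply/eqP.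
by apply: eq_bigr => p; rewrite in_piece => /andP[_ /eqP->].
Qed.

Lemma innerP A i : A != fset0 -> (forall p, p \in A -> f p = i) -> inner A /\ lo A = i.
Proof.
move=> A0 Ai; have [p pA <-] := lo_attained A0; split; last exact: Ai.
by apply/allP => q qA; apply/eqP; rewrite Ai // -(Ai p) //; have := lo_attained A0 => -[r rA <-]; rewrite !Ai.
Qed.

Lemma inner_piece A i : inner A -> piece A i = if lo A == i then A else fset0.
Proof.
move=> /allP iA; apply/fsetP => p; rewrite in_piece.
case pA: (p \in A); last by case: ifP; rewrite ?pA.
by rewrite (eqP (iA _ pA)); case: ifP.
Qed.

Lemma inner_spread A : A != fset0 -> inner A -> spread A = 0.
Proof.
move=> A0 iA; rewrite /spread (bigD1 (Ordinal (lo_lt A0))) //= inner_piece // eqxx.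
rewrite big1 ?addr0 ?subrr // => i; rewrite -val_eqE /= => ne.
by rewrite inner_piece // eq_sym (negPf ne) /Delta big_seq_fset0.
Qed.

Lemma inner_weight A : A != fset0 -> inner A -> weight A = 4 * refcost A.
Proof. by move=> A0 iA; rewrite /weight inner_spread // mulr0 addr0. Qed.

Lemma inner_narrow A : inner A -> narrow A.
Proof. by apply: sub_all => p /eqP->. Qed.

Lemma inner_home A : inner A -> home A = lo A.
Proof. by move=> iA; rewrite /home inner_piece // eqxx leq_pmull. Qed.

Lemma innerU A B : A != fset0 -> inner A -> inner B -> lo A = lo B ->
  inner (A `|` B) /\ lo (A `|` B) = lo A.
Proof.
move=> A0 /allP iA /allP iB E; apply: innerP.
  by case/fset0Pn: A0 => x xA; apply/fset0Pn; exists x; rewrite inE xA.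
by move=> p; rewrite in_fsetU => /orP[/iA|/iB] /eqP->.
Qed.

Lemma narrow_card A : narrow A ->
  #|` A| = (#|` piece A (lo A)| + #|` piece A (lo A).+1|)%N.
Proof.
move=> /allP nA; rewrite -cardfsU_disjoint; last first.
  apply/fdisjointP => p; rewrite !in_piece => /andP[_ /eqP->].
  by rewrite ltn_eqF ?andbF.
congr #|` _|; apply/fsetP => p; rewrite in_fsetU !in_piece -andb_orr.
case pA: (p \in A) => //=; have := nA _ pA; have := lo_le pA.
by move=> h1 h2; apply/esym/orP; rewrite -!(rwP eqP); lia.
Qed.

Lemma home_card A : narrow A -> (#|` A| <= 2 * #|` piece A (home A)|)%N.
Proof.
move=> /narrow_card E; rewrite /home; case: ifP => // /negbT; rewrite -ltnNge.
rewrite E; lia.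
Qed.

Lemma home_touch A : A != fset0 -> narrow A -> exists2 p, p \in A & f p = home A.
Proof.
move=> A0 nA; have := home_card nA; have : (0 < #|` A|)%N by rewrite cardfs_gt0.
move=> a0 h; have : (0 < #|` piece A (home A)|)%N by lia.
rewrite cardfs_gt0 => /fset0Pn[p]; rewrite in_piece => /andP[pA /eqP fp].
by exists p.
Qed.

Lemma home_lt A : A != fset0 -> narrow A -> (home A < K)%N.
Proof. by move=> A0 nA; have [p _ <-] := home_touch A0 nA. Qed.

Lemma home_or A : home A = lo A \/ home A = (lo A).+1.
Proof. by rewrite /home; case: ifP; [left|right]. Qed.

(** Go from [mean A] to the center through the mean of the majority piece. The factor 4 in [weight]
    is 2 for the majority times 2 from [(v - u)^2 <= 2 u^2 + 2 v^2]. *)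
Lemma home_mean_le A : A != fset0 -> narrow A ->
  #|` A|%:R * (mean A - ctr (home A)) ^+ 2 <= weight A.
Proof.
move=> A0 nA; set h := home A; set Z := piece A h.
have cZ : #|` A|%:R <= 2 * #|` Z|%:R :> R.
  by rewrite -[2]/(2%:R) -natrM ler_nat home_card.
have hK : (h < K)%N by apply: home_lt.
have sZ : #|` Z|%:R * (mean Z - mean A) ^+ 2 <= spread A.
  rewrite spreadE (bigD1 (Ordinal hK)) //= lerDl.
  by apply: sumr_ge0 => i _; rewrite mulr_ge0 ?ler0n ?sqr_ge0.
have wZ : #|` Z|%:R * (mean Z - ctr h) ^+ 2 <= refcost A.
  apply: le_trans (refcost_sub (piece_sub A h)); rewrite -/Z.
  have -> : refcost Z = \sum_(p <- Z) (p - ctr h) ^+ 2.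
    rewrite /refcost big_seq [RHS]big_seq; apply: eq_bigr => p.
    by rewrite in_piece => /andP[_ /eqP->].
  by rewrite sumsq_shift lerDr Delta_ge0.
have := ler_wpM2r (sqr_ge0 (mean A - ctr h)) cZ.
set u := mean Z - mean A in sZ; set v := mean Z - ctr h in wZ.
have -> : mean A - ctr h = v - u by rewrite /u /v; ring.
have := mulr_ge0 (ler0n R #|` Z|) (sqr_ge0 (v + u)).
rewrite /weight; nra.
Qed.

(** The common home center serves as comparison point for both clusters. *)
Lemma merge_cost_home A B : A != fset0 -> B != fset0 -> narrow A -> narrow B ->
  [disjoint A & B] -> home A = home B -> merge_cost A B <= weight A + weight B.
Proof.
move=> A0 B0 nA nB dAB E; have := merge_cost_le (ctr (home A)) dAB.
by have := home_mean_le A0 nA; have := home_mean_le B0 nB; rewrite -E; lra.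
Qed.

Lemma loU A B : A != fset0 -> B != fset0 -> lo (A `|` B) = minn (lo A) (lo B).
Proof.
move=> A0 B0; have U0 : A `|` B != fset0.
  by case/fset0Pn: A0 => x xA; apply/fset0Pn; exists x; rewrite inE xA.
apply/eqP; rewrite eqn_leq leq_min; apply/andP; split.
  have [p pA <-] := lo_attained A0; have [q qB <-] := lo_attained B0.
  by rewrite !lo_le ?in_fsetU ?pA ?qB ?orbT.
have [p + <-] := lo_attained U0; rewrite geq_min in_fsetU.
by case/orP => /lo_le->; rewrite ?orbT.
Qed.

(** Piece sizes add up under disjoint union, so a majority shared by [A] and [B] passes to the
    union. *)
Lemma homeU A B : A != fset0 -> B != fset0 -> [disjoint A & B] ->
  narrow (A `|` B) -> narrow A -> narrow B ->
  home A = home B -> home (A `|` B) = home A.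
Proof.
move=> A0 B0 dAB nU nA nB E; have eL := loU A0 B0.
have le1 X : X `<=` A `|` B -> X != fset0 -> (lo X <= (lo (A `|` B)).+1)%N.
  move=> /fsubsetP XU X0; have [p pX <-] := lo_attained X0.
  exact: (allP nU _ (XU _ pX)).
have lA := le1 _ (fsubsetUl A B) A0; have lB := le1 _ (fsubsetUr A B) B0.
set a := lo (A `|` B) in eL lA lB.
have cU : #|` A `|` B| = (#|` A| + #|` B|)%N by apply: cardfsU_disjoint.
have cp : #|` piece (A `|` B) a| = (#|` piece A a| + #|` piece B a|)%N.
  by rewrite pieceU cardfsU_disjoint // piece_disjoint.
(* Home [a] means that at least half of [X] lies there. When [X] starts at [a.+1], its piece at [a]
   is empty and the strict inequality holds. *)
have hX X : X != fset0 -> narrow X -> (a <= lo X <= a.+1)%N ->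
    (home X = a /\ #|` X| <= 2 * #|` piece X a|)%N \/
    (home X <> a /\ 2 * #|` piece X a| < #|` X|)%N.
  move=> X0 nX; rewrite leq_eqVlt => /andP[/orP[/eqP aX _|aX Xa]].
    rewrite /home aX; case: leqP => h; [left | right] => //; split => //; lia.
  have {Xa}lX : lo X = a.+1 by lia.
  right; split; first by case: (home_or X) => ->; rewrite lX; lia.
  have -> : piece X a = fset0.
    apply/fsetP => p; rewrite in_piece; apply/negbTE/negP => /andP[/lo_le h /eqP e].
    by rewrite lX e ltnn in h.
  by rewrite cardfs0 muln0 cardfs_gt0.
have aA : (a <= lo A <= a.+1)%N by rewrite lA eL geq_minl.
have aB : (a <= lo B <= a.+1)%N by rewrite lB eL geq_minr.
have hA := hX _ A0 nA aA; have hB := hX _ B0 nB aB.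
have hU := home_or (A `|` B); rewrite -/a in hU.
have hAor := home_or A; have hBor := home_or B.
rewrite [LHS]/home -/a cU cp; case: ifP => [|/negbT]; rewrite -?ltnNge => h; lia.
Qed.

End Pieces.

(** * Clusterings into convex clusters *)

Section Clusterings.
Variables (R : realType) (P : {fset R}).
Implicit Types (A B X : {fset R}) (Cs : {fset {fset R}}).

Definition convex_in A : Prop :=
  forall x y p, x \in A -> y \in A -> p \in P -> x <= p -> p <= y -> p \in A.

Record clustering Cs : Prop := Clustering {
  clustering_neq0 : forall X, X \in Cs -> X != fset0;
  clustering_sub : forall X, X \in Cs -> X `<=` P;
  clustering_disj : forall X Y, X \in Cs -> Y \in Cs -> X != Y -> [disjoint X & Y];
  clustering_cover : forall p, p \in P -> exists2 X, X \in Cs & p \in X;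
  clustering_convex : forall X, X \in Cs -> convex_in X }.

Definition least_pair Cs A B : Prop :=
  forall A' B', A' \in Cs -> B' \in Cs -> A' != B' ->
    merge_cost A B <= merge_cost A' B'.

Lemma fsetU_neq0 A B : A != fset0 -> A `|` B != fset0.
Proof. by case/fset0Pn => x xA; apply/fset0Pn; exists x; rewrite inE xA. Qed.

Lemma convex_before A M x p : convex_in A -> convex_in M ->
  A `<=` P -> M `<=` P -> [disjoint A & M] -> x \in A -> p \in M -> x < p ->
  forall a m, a \in A -> m \in M -> a < m.
Proof.
move=> cA cM /fsubsetP AP /fsubsetP MP dAM xA pM xp a m aA mM.
have dis z : z \in A -> z \in M -> False.
  by move=> zA zM; have := fdisjointP dAM _ zA; rewrite zM.
rewrite ltNge; apply/negP => ma.
have [mx|xm] := leP m x.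
  by apply: (dis x) => //; apply: (cM m p) => //; [apply: AP | apply: ltW].
by apply: (dis m) => //; apply: (cA x a) => //; [apply: MP | apply: ltW].
Qed.

(** A point missed between [A] and [B] would lie in a third cluster [M]. Disjoint convex clusters
    are ordered, hence so are their means, and [merge_cost_between] contradicts minimality. *)
Lemma merged_convex Cs A B : clustering Cs -> A \in Cs -> B \in Cs -> A != B ->
  least_pair Cs A B -> convex_in (A `|` B).
Proof.
move=> cCs; move: A B.
have key A B x y p : A \in Cs -> B \in Cs -> A != B -> least_pair Cs A B ->
    x \in A -> y \in B -> p \in P -> x <= p -> p <= y -> p \in A `|` B.
  move=> ACs BCs AB min xA yB pP xp py; apply/negPn/negP; rewrite in_fsetU negb_or => /andP[pA pB].
  have [M MCs pM] := clustering_cover cCs pP.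
  have AM : A != M by apply: contraNneq pA => ->.
  have MB : M != B by apply: contraNneq pB => <-.
  have {}xp : x < p by rewrite lt_neqAle xp andbT; apply: contraNneq pA => <-.
  have {}py : p < y by rewrite lt_neqAle py andbT; apply: contraNneq pB => ->.
  have lt X Y u v : X \in Cs -> Y \in Cs -> X != Y -> u \in X -> v \in Y -> u < v -> mean X < mean Y.
    move=> XCs YCs XY uX vY uv; apply: mean_lt; try exact: (clustering_neq0 cCs).
    exact: (convex_before (clustering_convex cCs XCs) (clustering_convex cCs YCs)
      (clustering_sub cCs XCs) (clustering_sub cCs YCs)
      (clustering_disj cCs XCs YCs XY) uX vY uv).
  have n0 X : X \in Cs -> X != fset0 := @clustering_neq0 _ cCs X.
  have dj X Y : X \in Cs -> Y \in Cs -> X != Y -> [disjoint X & Y] := @clustering_disj _ cCs X Y.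
  apply: (@merge_cost_between _ A B M); rewrite ?n0 ?dj //.
  - exact: (lt _ _ x p).
  - exact: (lt _ _ p y).
  - exact: min.
  - exact: min.
move=> A B ACs BCs AB min x y p; rewrite !in_fsetU.
have minC : least_pair Cs B A by move=> X Y; rewrite merge_costC; apply: min.
move=> /orP[xA|xB] /orP[yA|yB] pP xp py; rewrite -in_fsetU.
- by rewrite in_fsetU (clustering_convex cCs ACs xA yA).
- exact: (key A B x y).
- by rewrite fsetUC; apply: (key B A x y) => //; rewrite eq_sym.
- by rewrite in_fsetU (clustering_convex cCs BCs xB yB) ?orbT.
Qed.

Definition merged Cs A B : {fset {fset R}} := (A `|` B) |` (Cs `\ A `\ B).

Lemma in_merge Cs A B X :
  (X \in merged Cs A B) = (X == A `|` B) || [&& X != B, X != A & X \in Cs].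
Proof. by rewrite in_fset1U !in_fsetD1. Qed.

(** By disjointness a cluster contained in another one equals it. As clusterings are sets, the union
    must be new for the count to fall by exactly one and for sums to split. *)
Lemma merged_notin Cs A B : clustering Cs -> A \in Cs -> B \in Cs -> A != B ->
  A `|` B \notin Cs.
Proof.
move=> cCs ACs BCs AB; apply/negP => UCs.
have nU X : X \in Cs -> X `<=` A `|` B -> X = A `|` B.
  move=> XCs XU; apply/eqP/negPn/negP => ne.
  have [p pX] := fset0Pn _ (clustering_neq0 cCs XCs).
  by have := fdisjointP (clustering_disj cCs XCs UCs ne) _ pX; rewrite (fsubsetP XU).
by case/eqP: AB; rewrite (nU A) ?fsubsetUl // -(nU B) ?fsubsetUr.
Qed.

Lemma clustering_merge Cs A B : clustering Cs -> A \in Cs -> B \in Cs -> A != B ->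
  least_pair Cs A B -> clustering (merged Cs A B).
Proof.
move=> cCs ACs BCs AB min.
have dU X : X \in Cs -> X != A -> X != B -> [disjoint A `|` B & X].
  by move=> XCs XA XB; rewrite fdisjointUX !(clustering_disj cCs) // eq_sym.
split.
- move=> X; rewrite in_merge => /orP[/eqP->|/and3P[_ _ XCs]].
    by rewrite fsetU_neq0 // (clustering_neq0 cCs).
  exact: (clustering_neq0 cCs).
- move=> X; rewrite in_merge => /orP[/eqP->|/and3P[_ _ XCs]].
    by rewrite fsubUset !(clustering_sub cCs).
  exact: (clustering_sub cCs).
- move=> X Y; rewrite !in_merge => /orP[/eqP->|/and3P[XB XA XCs]] /orP[/eqP->|/and3P[YB YA YCs]].
  + by rewrite eqxx.
  + by move=> _; apply: dU.
  + by move=> _; rewrite fdisjoint_sym; apply: dU.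
  + exact: (clustering_disj cCs).
- move=> p /(clustering_cover cCs)[X XCs pX].
  have [E|XA] := eqVneq X A; first by exists (A `|` B); rewrite ?in_merge ?eqxx // inE -E pX.
  have [E|XB] := eqVneq X B; first by exists (A `|` B); rewrite ?in_merge ?eqxx // inE -E pX orbT.
  by exists X; rewrite // in_merge XA XB XCs orbT.
- move=> X; rewrite in_merge => /orP[/eqP->|/and3P[_ _ XCs]].
    exact: (merged_convex cCs).
  exact: (clustering_convex cCs).
Qed.

(** This makes the merge costs monotone along a run: pairs containing the union are handled by
    reducibility, old pairs by minimality. *)
Lemma least_pair_merge Cs A B : clustering Cs -> A \in Cs -> B \in Cs -> A != B ->
  least_pair Cs A B -> forall X Y, X \in merged Cs A B -> Y \in merged Cs A B ->
  X != Y -> merge_cost A B <= merge_cost X Y.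
Proof.
move=> cCs ACs BCs AB min.
have red X : X \in Cs -> X != A -> X != B -> merge_cost A B <= merge_cost (A `|` B) X.
  move=> XCs XA XB; apply: merge_cost_reducible; try exact: (clustering_neq0 cCs).
  - exact: (clustering_disj cCs).
  - by apply: (clustering_disj cCs) => //; rewrite eq_sym.
  - by apply: (clustering_disj cCs) => //; rewrite eq_sym.
  - by apply: min => //; rewrite eq_sym.
  - by apply: min => //; rewrite eq_sym.
move=> X Y; rewrite !in_merge => /orP[/eqP->|/and3P[XB XA XCs]] /orP[/eqP->|/and3P[YB YA YCs]].
- by rewrite eqxx.
- by move=> _; apply: red.
- by move=> _; rewrite [leRHS]merge_costC; apply: red.
- exact: min.
Qed.

Lemma card_merge Cs A B : clustering Cs -> A \in Cs -> B \in Cs -> A != B ->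
  #|` Cs| = #|` merged Cs A B|.+1.
Proof.
move=> cCs ACs BCs AB; rewrite /merged cardfsU1 !in_fsetD1.
rewrite (negPf (merged_notin cCs ACs BCs AB)) !andbF /=.
by rewrite (cardfsD1 A Cs) ACs (cardfsD1 B (Cs `\ A)) in_fsetD1 BCs eq_sym AB.
Qed.

Lemma clustering_singletons : clustering (singletons P).
Proof.
have sP X : X \in singletons P -> exists2 p, p \in P & X = [fset p].
  by case/imfsetP => p /= pP ->; exists p.
split.
- by move=> X /sP[p _ ->]; apply/fset0Pn; exists p; rewrite inE.
- by move=> X /sP[p pP ->]; rewrite fsub1set.
- move=> X Y /sP[p _ ->] /sP[q _ ->] ne; rewrite fdisjoint1X inE.
  by apply: contraNneq ne => ->.
- by move=> p pP; exists [fset p]; rewrite ?inE //; apply/imfsetP; exists p.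
- move=> X /sP[p _ ->] x y q; rewrite !inE => /eqP-> /eqP-> _ h1 h2.
  by rewrite eq_le h2 h1.
Qed.

End Clusterings.

(** * The potential *)

Section Potential.
Variables (R : realType) (f : R -> nat) (ctr : nat -> R) (K : nat) (P : {fset R}).
Hypothesis f_lt : forall p, (f p < K)%N.
Implicit Types (A B X : {fset R}) (L M : {fset {fset R}}) (d : R).

Local Notation wt := (weight f ctr K).
Local Notation lo := (lo f K).
Local Notation home := (home f K).
Local Notation inner := (inner f K).
Local Notation narrow := (narrow f K).

Definition inners L : {fset {fset R}} := [fset X in L | inner X].

Definition has_inner L (i : nat) : bool := fiber lo (inners L) i != fset0.

(** For a narrow straddling [X], the exponent counts which of its two reference clusters still
    contain an inner cluster of [L]; 512 dominates every such power. *)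
Definition multiplier L X : R :=
  if inner X then 512 else 16 ^+ (has_inner L (lo X) + has_inner L (lo X).+1).

Definition weighted L : R := \sum_(X <- L) multiplier L X * wt X.

Definition refpair (i : nat) : R :=
  refcost f ctr (piece f P i) + refcost f ctr (piece f P i.+1).

(** A reserve for each border with inner clusters on both sides, released when one side loses its
    last one. *)
Definition boundary L : R :=
  \sum_(i < K) if has_inner L i && has_inner L i.+1 then refpair i else 0.

(* Absorbing an inner cluster into a straddling one costs [9 d] plus a
   multiplier times [4 d]. This is [(9 + 4 * 256) d = 2066 (d / 2)] in general, and
   [(9 + 4 * 16) d = 73 d] once the last inner cluster of a reference cluster is
   gone; there [d] is at most a weight plus [4] times a reference cost, whence
   [292 = 4 * 73]. *)
Definition side_potential L : R :=
  2066 * total_excess wt K lo (inners L) + weighted L + 292 * boundary L.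

(** The factor 2 turns an excess drop of [d / 2] into a payment of [d]. *)
Definition potential L : R := 2 * total_excess wt K home L + side_potential L.

Let wt_ge0 X : 0 <= wt X := weight_ge0 ctr f_lt X.

Lemma in_inners L X : (X \in inners L) = (X \in L) && inner X.
Proof. by rewrite !inE. Qed.

Lemma inners_sub L M : M `<=` L -> inners M `<=` inners L.
Proof.
by move=> ML; apply/fsubsetP => X; rewrite !in_inners => /andP[/(fsubsetP ML)-> ->].
Qed.

Lemma has_innerP L i :
  reflect (exists X, [/\ X \in L, inner X & lo X = i]) (has_inner L i).
Proof.
apply: (iffP (fset0Pn _)) => -[X].
  by rewrite in_fiber in_inners => /andP[/andP[XL iX] /eqP lX]; exists X.
by case=> XL iX lX; exists X; rewrite in_fiber in_inners XL iX lX eqxx.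
Qed.

Lemma has_inner_sub L M i : M `<=` L -> has_inner M i -> has_inner L i.
Proof.
move=> /fsubsetP ML /has_innerP[X [XM iX lX]]; apply/has_innerP.
by exists X; split=> //; apply: ML.
Qed.

Lemma has_inner_le L M i : M `<=` L -> (has_inner M i <= has_inner L i)%N.
Proof. by move=> ML; have := @has_inner_sub L M i ML; case: has_inner => // ->. Qed.

Lemma multiplier_ge1 L X : 1 <= multiplier L X.
Proof. by rewrite /multiplier; case: ifP => _; [lra | rewrite exprn_ege1 //; lra]. Qed.

Lemma exp16 n : (n <= 2)%N -> (16 : R) ^+ n <= 256.
Proof. by case: n => [|[|[|]]] // _; rewrite ?expr0 ?expr1 ?expr2; lra. Qed.

Lemma multiplier_le L X : ~~ inner X -> multiplier L X <= 256.
Proof.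
move=> /negPf iX; rewrite /multiplier iX exp16 //.
by case: (has_inner _ _); case: (has_inner _ _).
Qed.

Lemma multiplier_sub L M X : M `<=` L -> multiplier M X <= multiplier L X.
Proof.
move=> ML; rewrite /multiplier; case: ifP => // _; rewrite ler_eXn2l; last lra.
exact: leq_add (has_inner_le _ ML) (has_inner_le _ ML).
Qed.

Lemma multiplier_drop L M X i : M `<=` L -> ~~ inner X ->
  i = lo X \/ i = (lo X).+1 -> has_inner L i -> ~~ has_inner M i ->
  16 * multiplier M X <= multiplier L X.
Proof.
move=> ML /negPf iX iE Li /negPf Mi; rewrite /multiplier iX -exprS ler_eXn2l; last lra.
have := has_inner_le (lo X) ML; have := has_inner_le (lo X).+1 ML.
case: iE => E; rewrite E in Li Mi; rewrite Li Mi; lia.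
Qed.

Lemma weighted_sub_sum L M (S : {fset {fset R}}) : M `<=` L ->
  \sum_(X <- S) multiplier M X * wt X <= \sum_(X <- S) multiplier L X * wt X.
Proof.
by move=> ML; apply: ler_sum => X _; rewrite ler_wpM2r // multiplier_sub.
Qed.

Lemma refpair_ge0 i : 0 <= refpair i.
Proof. by rewrite addr_ge0 // refcost_ge0. Qed.

Lemma boundary_sub L M : M `<=` L -> boundary M <= boundary L.
Proof.
move=> ML; apply: ler_sum => i _; have r0 := refpair_ge0 i.
have := @has_inner_sub _ _ i ML; have := @has_inner_sub _ _ i.+1 ML.
case: (has_inner M i); case: (has_inner M i.+1) => /= h1 h2; last first.
- by case: ifP.
- by case: ifP.
- by case: ifP.
by rewrite (h1 isT) (h2 isT).
Qed.

Lemma boundary_drop L M i : M `<=` L -> (i < K)%N ->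
  has_inner L i -> has_inner L i.+1 -> ~~ (has_inner M i && has_inner M i.+1) ->
  boundary M + refpair i <= boundary L.
Proof.
move=> ML iK Li Li1 /negPf Mi; rewrite /boundary -[X in _ + X <= _](sum_at (V := R) (refpair i) iK).
rewrite -big_split /=; apply: ler_sum => j _; have r0 := refpair_ge0 j.
case: eqVneq => [<-|_]; first by rewrite Mi Li Li1 add0r.
rewrite addr0.
have := @has_inner_sub _ _ j ML; have := @has_inner_sub _ _ j.+1 ML.
case: (has_inner M j); case: (has_inner M j.+1) => /= h1 h2; last first.
- by case: ifP.
- by case: ifP.
- by case: ifP.
by rewrite (h1 isT) (h2 isT).
Qed.

Lemma weighted_sub L M : M `<=` L -> weighted M <= weighted L.
Proof.
move=> ML; apply: le_trans (weighted_sub_sum M ML) _.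
rewrite /weighted [leRHS](big_fsetID _ (mem M)) /=.
have -> : [fset X in L | X \in M] = M.
  by apply/fsetP=> X; rewrite !inE; case XM: (X \in M); rewrite ?andbF ?andbT ?(fsubsetP ML).
rewrite lerDl sumr_ge0 // => X _; rewrite mulr_ge0 //.
by have := multiplier_ge1 L X; lra.
Qed.

(** Discarded clusters take their weight away, and fewer inner clusters only lower multipliers and
    reserves. *)
Lemma side_potential_sub L M : M `<=` L -> side_potential M <= side_potential L.
Proof.
move=> ML; have := total_excess_sub K wt_ge0 lo (inners_sub ML).
by have := weighted_sub ML; have := boundary_sub ML; rewrite /side_potential; lra.
Qed.

End Potential.

(** * The invariant and the effect of a single merge *)

Section Step.
Variables (R : realType) (f : R -> nat) (ctr : nat -> R) (K : nat) (P : {fset R}).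
Hypothesis f_lt : forall p, (f p < K)%N.
Hypothesis f_mono : {in P &, forall p q, p <= q -> (f p <= f q)%N}.
Implicit Types (A B X : {fset R}) (Cs L M : {fset {fset R}}) (d : R).

Local Notation wt := (weight f ctr K).
Local Notation lo := (lo f K).
Local Notation home := (home f K).
Local Notation inner := (inner f K).
Local Notation narrow := (narrow f K).
Local Notation spread := (spread f K).
Local Notation surplus := (surplus K home).
Local Notation texcess := (total_excess wt K home).
Local Notation pot := (potential f ctr K P).
Local Notation side := (side_potential f ctr K P).
Local Notation refcost := (refcost f ctr).
Local Notation mult := (multiplier f K).
Local Notation hasI := (has_inner f K).
Local Notation inners := (inners f K).

Definition touches X (i : nat) : Prop := exists2 p, p \in X & f p = i.

Definition total_spread Cs : R := \sum_(X <- Cs) spread X.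

(* [L] is the set of live clusters, [b] counts the merges whose cost is not
   paid by a decrease of the potential. *)
Record ward_invariant Cs L (b : nat) d : Prop := WardInvariant {
  inv_live : L `<=` Cs;
  inv_inner : forall X, X \in Cs -> inner X -> X \in L;
  inv_narrow : forall X, X \in L -> narrow X;
  inv_touch : forall i, (i < K)%N -> (exists2 X, X \in L & home X = i) \/
    (exists X, [/\ X \in Cs, X \notin L & touches X i]);
  inv_card : (#|` Cs| + b <= K + surplus L)%N;
  inv_energy : total_spread Cs + pot L <= 11000 * refcost P + b%:R * d }.

Let wt_ge0 X : 0 <= wt X := weight_ge0 ctr f_lt X.

Section OneStep.
Variables (Cs L : {fset {fset R}}) (b : nat) (d : R).
Hypothesis cCs : clustering P Cs.
Hypothesis I : ward_invariant Cs L b d.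
Hypothesis d_ge0 : 0 <= d.
Hypothesis d_le : forall X Y, X \in Cs -> Y \in Cs -> X != Y -> d <= merge_cost X Y.

Let n0 X : X \in Cs -> X != fset0 := @clustering_neq0 _ P Cs cCs X.
Let dj X Y : X \in Cs -> Y \in Cs -> X != Y -> [disjoint X & Y] :=
  @clustering_disj _ P Cs cCs X Y.
Let LCs X : X \in L -> X \in Cs := fsubsetP (inv_live I) X.

Lemma same_home_bound X Y : X \in L -> Y \in L -> X != Y -> home X = home Y ->
  d <= wt X + wt Y.
Proof.
move=> XL YL XY E; apply: le_trans (d_le (LCs XL) (LCs YL) XY) _.
have XCs := LCs XL; have YCs := LCs YL.
apply: (merge_cost_home ctr f_lt (n0 XCs) (n0 YCs)) E.
- exact: inv_narrow I _ XL.
- exact: inv_narrow I _ YL.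
- exact: dj.
Qed.

Lemma fiber_home_bound M i : M `<=` L -> pair_bound wt d (fiber home M i).
Proof.
move=> /fsubsetP ML X Y; rewrite !in_fiber => /andP[XM /eqP Xi] /andP[YM /eqP Yi] XY.
by apply: same_home_bound; rewrite ?ML // Xi.
Qed.

Lemma fiber_lo_bound i : pair_bound wt d (fiber lo (inners L) i).
Proof.
move=> X Y; rewrite !in_fiber !in_inners.
move=> /andP[/andP[XM iX] /eqP Xi] /andP[/andP[YM iY] /eqP Yi] XY.
by apply: same_home_bound; rewrite // !inner_home // Xi.
Qed.

(** The two ways to charge a merge with dead result: with unchanged surplus [b] is incremented,
    otherwise the excess pays. *)
Definition paid_drop L1 L2 : Prop :=
  surplus L2 = surplus L1 \/
  surplus L1 = (surplus L2).+1 /\ texcess L2 + d / 2 <= texcess L1.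

Lemma paid_dropD1 M X : M `<=` L -> paid_drop M (M `\ X).
Proof.
move=> ML; have [XM|XM] := boolP (X \in M); last first.
  by left; congr surplus; apply/fsetP => Y; rewrite in_fsetD1; case: eqVneq => // ->; rewrite (negPf XM).
have XL := fsubsetP ML _ XM.
have hK : (home X < K)%N by apply: home_lt => //; [apply/n0/LCs | apply: (inv_narrow I)].
rewrite /paid_drop (surplusD1 XM hK); case: leqP => r; [left | right].
  by rewrite addn0.
rewrite addn1; split=> //; apply: total_excessD1_half => // i.
exact: fiber_home_bound.
Qed.

(** Such a [Y] keeps the home of [X] occupied after [A] and [B] are merged. *)
Definition mate A B X : Prop :=
  exists Y, [/\ Y \in L, Y != A, Y != B & home Y = home X].

Section OnePair.
Variables A B : {fset R}.
Hypotheses (ACs : A \in Cs) (BCs : B \in Cs) (AB : A != B) (dE : merge_cost A B = d).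

Lemma total_spread_merge :
  total_spread (merged Cs A B) + spread A + spread B =
  total_spread Cs + spread (A `|` B).
Proof.
have BA : B \in Cs `\ A by rewrite in_fsetD1 eq_sym AB.
rewrite /total_spread [in RHS](big_fsetD1 A) //= [in RHS](big_fsetD1 B) //=.
rewrite big_fsetU1 /=; last first.
  by rewrite !in_fsetD1 (negPf (merged_notin cCs ACs BCs AB)) !andbF.
ring.
Qed.

Lemma spread_merged : spread (A `|` B) <= spread A + spread B + d.
Proof. by rewrite -dE; apply: spreadU => //; apply: dj. Qed.

Lemma merged_notin_live : A `|` B \notin L.
Proof. by apply: contra (merged_notin cCs ACs BCs AB) => /LCs. Qed.

Lemma live_sub2 : L `\ A `\ B `<=` L.
Proof. by apply/fsubsetP => X; rewrite !in_fsetD1 => /and3P[]. Qed.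

Lemma in_live2 X : (X \in L `\ A `\ B) = [&& X != B, X != A & X \in L].
Proof. by rewrite !in_fsetD1. Qed.

Lemma touchesU X i : X = A \/ X = B -> touches X i -> touches (A `|` B) i.
Proof.
by move=> XAB [p pX fp]; exists p => //; rewrite in_fsetU; case: XAB pX => -> ->; rewrite ?orbT.
Qed.

(** The union touches everything that [A] and [B] touched, so as a dead cluster it replaces them in
    [inv_touch]. The spread rises by at most [d], which is charged as [paid_drop] allows. *)
Lemma dead_step : ~~ inner (A `|` B) -> paid_drop L (L `\ A `\ B) ->
  exists b', ward_invariant (merged Cs A B) (L `\ A `\ B) b' d.
Proof.
move=> nC drop.
have tC i X : X = A \/ X = B -> touches X i ->
    exists X, [/\ X \in merged Cs A B, X \notin L `\ A `\ B & touches X i].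
  move=> XAB tX; exists (A `|` B); rewrite in_merge eqxx in_live2.
  by rewrite (negPf merged_notin_live) !andbF; split=> //; apply: touchesU tX.
have mk b' : (#|` merged Cs A B| + b' <= K + surplus (L `\ A `\ B))%N ->
    total_spread (merged Cs A B) + pot (L `\ A `\ B) <= 11000 * refcost P + b'%:R * d ->
    ward_invariant (merged Cs A B) (L `\ A `\ B) b' d.
  move=> hc he; split=> //.
  - by apply/fsubsetP => X; rewrite in_live2 in_merge => /and3P[-> -> /LCs ->]; rewrite orbT.
  - move=> X; rewrite in_merge in_live2 => /orP[/eqP-> iC|/and3P[-> -> XCs] iX].
      by rewrite iC in nC.
    exact: inv_inner I _ XCs iX.
  - by move=> X /(fsubsetP live_sub2) /(inv_narrow I).
  - move=> i /(inv_touch I) [[X XL hX]|[X [XCs XL tX]]]; last first.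
      have [XA|XA] := eqVneq X A; first by right; apply: (tC i X) => //; left.
      have [XB|XB] := eqVneq X B; first by right; apply: (tC i X) => //; right.
      by right; exists X; rewrite in_merge XB XA XCs orbT in_live2 (negPf XL) !andbF.
    have tX : touches X i.
      by rewrite -hX; apply: home_touch => //; [apply/n0/LCs | apply: (inv_narrow I)].
    have [XA|XA] := eqVneq X A; first by right; apply: (tC i X) => //; left.
    have [XB|XB] := eqVneq X B; first by right; apply: (tC i X) => //; right.
    by left; exists X => //; rewrite in_live2 XB XA.
have hc := inv_card I; have he := inv_energy I.
rewrite (card_merge cCs ACs BCs AB) in hc.
have hs := total_spread_merge; have hC := spread_merged.
have hp := side_potential_sub ctr P f_lt live_sub2.
have ht := total_excess_sub K wt_ge0 home live_sub2.
case: drop => [hS|[hS hd]].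
  exists b.+1; apply: mk; first by rewrite ?hS; clear -hc hS; lia.
  by move: he; rewrite /potential -natr1; lra.
exists b; apply: mk; first by rewrite ?hS; clear -hc hS; lia.
by move: he; rewrite /potential; lra.
Qed.

(** Here [e] bounds the growth of the weight, and [2 * e] pays for the home excess, which has
    coefficient 2 in [potential]. The union takes the home of [B], so only the home of [A] needs an
    occupant to be supplied. *)
Lemma live_step e : 0 <= e -> A \in L -> B \in L -> narrow (A `|` B) ->
  (inner (A `|` B) -> inner A /\ inner B) ->
  (exists2 Y, Y \in (A `|` B) |` (L `\ A `\ B) & home Y = home A) ->
  home (A `|` B) = home B ->
  (home A != home B -> (1 < #|` fiber home L (home A)|)%N) ->
  wt (A `|` B) <= wt A + wt B + e ->
  spread (A `|` B) + side ((A `|` B) |` (L `\ A `\ B)) + 2 * e <=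
    spread A + spread B + side L ->
  ward_invariant (merged Cs A B) ((A `|` B) |` (L `\ A `\ B)) b d.
Proof.
move=> e0 AL BL nC iC hA hC rA wC pay.
have hK X : X \in L -> (home X < K)%N.
  by move=> XL; apply: home_lt => //; [apply/n0/LCs | apply: (inv_narrow I)].
have [tx sp] := keyed_merge wt_ge0 e0 AL BL AB merged_notin_live (hK _ AL) (hK _ BL) hC rA wC.
have inL X : (X \in (A `|` B) |` (L `\ A `\ B)) = (X == A `|` B) || [&& X != B, X != A & X \in L].
  by rewrite in_fset1U in_live2.
split.
- apply/fsubsetP => X; rewrite inL in_merge => /orP[->//|/and3P[-> -> /LCs->]].
  by rewrite orbT.
- move=> X; rewrite in_merge inL => /orP[->//|/and3P[-> -> XCs] iX].
  by rewrite (inv_inner I) ?orbT.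
- by move=> X; rewrite inL => /orP[/eqP->//|/and3P[_ _ /(inv_narrow I)]].
- move=> i /(inv_touch I) [[X XL hX]|[X [XCs XL tX]]].
    have [XA|XA] := eqVneq X A; first by left; rewrite -hX XA.
    have [XB|XB] := eqVneq X B.
      by left; exists (A `|` B); rewrite ?inL ?eqxx // hC -XB.
    by left; exists X => //; rewrite inL XA XB XL orbT.
  have XA : X != A by apply: contraNneq XL => ->.
  have XB : X != B by apply: contraNneq XL => ->.
  right; exists X; rewrite in_merge inL XA XB XCs (negPf XL) orbT /= orbF.
  by split => //; apply: contraNneq (merged_notin cCs ACs BCs AB) => <-.
- by have := inv_card I; rewrite (card_merge cCs ACs BCs AB); clear -sp; lia.
- have := inv_energy I; have := total_spread_merge.
  by rewrite /potential; lra.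
Qed.

Lemma merged_member X p : X \in Cs -> p \in X -> p \in A `|` B -> X = A \/ X = B.
Proof.
move=> XCs pX; rewrite in_fsetU => /orP[pA|pB]; [left | right]; apply/eqP/negPn/negP => ne.
  by have := fdisjointP (dj XCs ACs ne) _ pX; rewrite pA.
by have := fdisjointP (dj XCs BCs ne) _ pX; rewrite pB.
Qed.

Hypotheses (AL : A \in L) (BL : B \in L) (mA : mate A B A) (mB : mate A B B).

Lemma home_touches X : X \in L -> touches X (home X).
Proof.
by move=> XL; apply: home_touch => //; [apply/n0/LCs | apply: (inv_narrow I)].
Qed.

(** No cluster besides [A] and [B], both live, would touch [m]. Yet [inv_touch] yields a dead one,
    or a live one with home [m]; the latter would be [A] or [B], and its mate would touch [m]
    too. *)
Lemma merged_not_covers m : (m < K)%N ->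
  (forall p, p \in P -> f p = m -> p \in A `|` B) -> False.
Proof.
move=> mK cover.
have mem X : X \in Cs -> touches X m -> X = A \/ X = B.
  move=> XCs [p pX fp]; apply: (merged_member XCs pX); apply: cover => //.
  exact: (fsubsetP (clustering_sub cCs XCs)).
have [[X XL hX]|[X [XCs XL tX]]] := inv_touch I mK; last first.
  by case: (mem X XCs tX) => E; rewrite E ?AL ?BL in XL.
have tX := home_touches XL; rewrite hX in tX.
have [Y [YL YA YB hY]] : mate A B X by case: (mem X (LCs XL) tX) => ->.
have tY := home_touches YL; rewrite hY hX in tY.
by case: (mem Y (LCs YL) tY) => E; rewrite E eqxx in YA YB.
Qed.

Hypothesis cU : convex_in P (A `|` B).

(** Otherwise, by convexity and monotonicity of [f], the union would contain the whole reference
    cluster following its first one. *)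
Lemma merged_narrow : narrow (A `|` B).
Proof.
have UP : {subset A `|` B <= P} by apply/fsubsetP; rewrite fsubUset !(clustering_sub cCs).
apply/allP => p pU /=; rewrite leqNgt; apply/negP => lt.
have [q qU fq] := lo_attained f_lt (fsetU_neq0 B (n0 ACs)).
apply: (@merged_not_covers (lo (A `|` B)).+1); first exact: ltn_trans lt (f_lt p).
move=> r rP fr; apply: (cU qU pU) => //; rewrite leNgt; apply/negP => /ltW h.
  by have := f_mono rP (UP _ qU) h; rewrite fq fr ltnn.
by have := f_mono (UP _ pU) rP h; rewrite fr leqNgt lt.
Qed.

Lemma lo_merged X : X = A \/ X = B -> lo X = lo (A `|` B) \/ lo X = (lo (A `|` B)).+1.
Proof.
move=> XAB; have [p pX fp] : exists2 p, p \in X & f p = lo X.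
  by apply: lo_attained => //; apply: n0; case: XAB => ->.
have pU : p \in A `|` B by rewrite in_fsetU; case: XAB pX => -> ->; rewrite ?orbT.
have := lo_le f K pU; have := allP merged_narrow _ pU; rewrite /= fp; lia.
Qed.

Lemma home_merged X : X = A \/ X = B -> home X = lo (A `|` B) \/ home X = (lo (A `|` B)).+1.
Proof.
move=> XAB; have XL : X \in L by case: XAB => ->.
have [p pX fp] := home_touches XL.
have pU : p \in A `|` B by rewrite in_fsetU; case: XAB pX => -> ->; rewrite ?orbT.
have := lo_le f K pU; have := allP merged_narrow _ pU; rewrite /= fp; lia.
Qed.

(** A straddling part that started one later would reach beyond the narrow union. *)
Lemma lo_noninner X : X = A \/ X = B -> ~~ inner X -> lo X = lo (A `|` B).
Proof.
move=> XAB; case: (lo_merged XAB) => // E /allPn[p pX /eqP ne].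
have pU : p \in A `|` B by rewrite in_fsetU; case: XAB pX => -> ->; rewrite ?orbT.
have := lo_le f K pX; have := allP merged_narrow _ pU; rewrite /=; lia.
Qed.

(** * Paying for a straddling union *)

Hypothesis nU : ~~ inner (A `|` B).

Local Notation M := (L `\ A `\ B).

Lemma multiplier_noninner L' X : ~~ inner X ->
  mult L' X = 16 ^+ (hasI L' (lo X) + hasI L' (lo X).+1).
Proof. by rewrite /multiplier => /negPf->. Qed.

Lemma side_potential_merged :
  side ((A `|` B) |` M) = side M + mult M (A `|` B) * wt (A `|` B).
Proof.
have UM : A `|` B \notin M by rewrite in_live2 (negPf merged_notin_live) !andbF.
have iE : inners ((A `|` B) |` M) = inners M.
  apply/fsetP => X; rewrite !in_inners in_fset1U.
  by case: eqVneq => // ->; rewrite (negPf nU) !andbF.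
have hE i : hasI ((A `|` B) |` M) i = hasI M i.
  by rewrite /has_inner iE.
have mE X : mult ((A `|` B) |` M) X = mult M X.
  by rewrite /multiplier !hE.
rewrite /side_potential iE /weighted big_fsetU1 //= mE.
rewrite (eq_bigr (fun X => mult M X * wt X)); last by move=> X _; rewrite mE.
rewrite /boundary (eq_bigr (fun i : 'I_K => if hasI M i && hasI M i.+1
  then refpair f ctr P i else 0)); last by move=> i _; rewrite !hE.
ring.
Qed.

Lemma weighted_split :
  weighted f ctr K L = mult L A * wt A + mult L B * wt B +
    \sum_(X <- M) mult L X * wt X.
Proof.
have BA : B \in L `\ A by rewrite in_fsetD1 eq_sym AB.
by rewrite /weighted (big_fsetD1 A) //= (big_fsetD1 B) //= addrA.
Qed.

Lemma weighted_removed :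
  weighted f ctr K M + mult L A * wt A + mult L B * wt B <= weighted f ctr K L.
Proof.
by have := weighted_sub_sum ctr f_lt M live_sub2; rewrite weighted_split /weighted; lra.
Qed.

(** The multiplier of [Y] falls from at least [16 m] to [m], where [1 <= m]. *)
Lemma weighted_mate Y i : Y \in M -> ~~ inner Y -> i = lo Y \/ i = (lo Y).+1 ->
  hasI L i -> ~~ hasI M i ->
  weighted f ctr K M + mult L A * wt A + mult L B * wt B + 15 * wt Y <=
    weighted f ctr K L.
Proof.
move=> YM nY iE Li Mi; have drop := multiplier_drop live_sub2 nY iE Li Mi.
rewrite weighted_split /weighted (big_fsetD1 Y) //= [in leRHS](big_fsetD1 Y) //=.
have := weighted_sub_sum ctr f_lt (M `\ Y) live_sub2.
have := ler_wpM2r (wt_ge0 Y) drop; have := multiplier_ge1 f K M Y => m1.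
have := ler_wpM2r (wt_ge0 Y) m1; lra.
Qed.

Lemma inner_excess_drop X : X \in L -> inner X -> X \notin M -> hasI M (lo X) ->
  total_excess wt K lo (inners M) + d / 2 <= total_excess wt K lo (inners L).
Proof.
move=> XL iX XM /has_innerP[Z [ZM iZ lZ]].
have ZX : Z != X by apply: contraNneq XM => <-.
have XI : X \in inners L by rewrite in_inners XL.
apply: le_trans (total_excessD1_half wt_ge0 d_ge0 fiber_lo_bound XI _ _).
- rewrite lerD2r; apply: total_excess_sub => //; apply/fsubsetP => Y.
  rewrite !in_fsetD1 !in_inners => /andP[YM ->]; rewrite (fsubsetP live_sub2) // !andbT.
  by apply: contraNneq XM => <-.
- by apply: lo_lt => //; apply/n0/LCs.
- rewrite (cardfsD1 X) in_fiber XI eqxx /= add1n ltnS cardfs_gt0; apply/fset0Pn.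
  by exists Z; rewrite in_fsetD1 ZX in_fiber in_inners (fsubsetP live_sub2) // iZ lZ eqxx.
Qed.

Lemma wt_merged : wt (A `|` B) <= wt A + wt B + 4 * d.
Proof. by rewrite -dE; apply: weightU => //; apply: dj. Qed.

(* The mate of [B] is not inner, so its multiplier drops when the inner
   clusters of its home disappear. *)
Lemma mate_pays : inner B -> ~~ hasI M (lo B) ->
  exists2 w, d <= w + wt B &
  weighted f ctr K M + mult L A * wt A + mult L B * wt B + 15 * w <= weighted f ctr K L.
Proof.
move=> iB MB; have [Y [YL YA YB hY]] := mB; rewrite (inner_home iB) in hY.
have YM : Y \in M by rewrite in_live2 YB YA.
have nY : ~~ inner Y.
  by apply: contra MB => iY; apply/has_innerP; exists Y; split=> //; rewrite -(inner_home iY).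
have LB : hasI L (lo B) by apply/has_innerP; exists B.
exists (wt Y); first by apply: same_home_bound; rewrite ?hY ?(inner_home iB).
apply: (weighted_mate YM nY _ LB MB); rewrite -hY.
by case: (home_or f K Y); [left | right].
Qed.

Lemma merged_multiplier_le : mult M (A `|` B) <= 256.
Proof. exact: multiplier_le. Qed.

Lemma scaled_wt_merged q : 0 <= q ->
  q * wt (A `|` B) <= q * wt A + q * wt B + 4 * (q * d).
Proof.
move=> q0; apply: le_trans (ler_wpM2l q0 wt_merged) _.
by rewrite le_eqVlt; apply/orP; left; apply/eqP; ring.
Qed.

(** Another inner cluster remains next to [X], so the inner excess drops by [d / 2], worth
    [9 d + 4 * 256 d]. The [9 d] consist of [d] for the spread and [2 * 4 d] for the home excess. *)
Lemma pay_by_inner X : X = A \/ X = B -> inner X -> hasI M (lo X) ->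
  (forall Y, Y = A \/ Y = B -> mult M (A `|` B) <= mult L Y) ->
  side ((A `|` B) |` M) + 9 * d <= side L.
Proof.
move=> XAB iX MX mY; rewrite side_potential_merged.
have XL : X \in L by case: XAB => ->.
have XM : X \notin M by rewrite in_live2; case: XAB => ->; rewrite eqxx ?andbF.
have hd := inner_excess_drop XL iX XM MX.
have hw := weighted_removed; have hb := boundary_sub f ctr K P live_sub2.
have m1 := multiplier_ge1 f K M (A `|` B); have m2 := merged_multiplier_le.
have hA := ler_wpM2r (wt_ge0 A) (mY A (or_introl erefl)).
have hB := ler_wpM2r (wt_ge0 B) (mY B (or_intror erefl)).
have hU := scaled_wt_merged (le_trans ler01 m1).
have hq := ler_wpM2r d_ge0 m2.
rewrite /side_potential; lra.
Qed.

(** A straddling [A] absorbs an inner [B]. If [B] was the last inner cluster of its reference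
    cluster, the multiplier falls by a factor 16, and the bill goes to a cluster that bounds [d]
    together with [A] or [B]. *)
Lemma pay_cross : ~~ inner A -> inner B -> side ((A `|` B) |` M) + 9 * d <= side L.
Proof.
move=> nA iB.
have lA : lo A = lo (A `|` B) := lo_noninner (or_introl erefl) nA.
have mAU L' : mult L' A = mult L' (A `|` B).
  by rewrite !multiplier_noninner // lA.
have B512 L' : mult L' B = 512 by rewrite /multiplier iB.
have LB : hasI L (lo B) by apply/has_innerP; exists B.
have m2 := merged_multiplier_le; have m1 := multiplier_ge1 f K M (A `|` B).
have [MB|MB] := boolP (hasI M (lo B)).
  apply: (pay_by_inner (or_intror erefl) iB MB) => Y [->|->]; last by rewrite B512; lra.
  by rewrite mAU multiplier_sub // live_sub2.
have lB := lo_merged (or_intror erefl : B = A \/ B = B).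
have hA := home_merged (or_introl erefl : A = A \/ A = B).
have hw := weighted_removed; have hb := boundary_sub f ctr K P live_sub2.
have ht := total_excess_sub K wt_ge0 lo (inners_sub f K live_sub2).
have drop : 16 * mult M (A `|` B) <= mult L A.
  by rewrite -mAU; apply: (multiplier_drop live_sub2 nA _ LB MB); rewrite lA.
(* Only one side can still have inner clusters, so the exponent is at most 1. *)
have q16 : mult M (A `|` B) <= 16.
  rewrite multiplier_noninner // -[leRHS]expr1 ler_eXn2l; last lra.
  by case: lB MB => -> /negPf->; case: (hasI _ _).
have wA := wt_ge0 A; have wB := wt_ge0 B.
have hU := scaled_wt_merged (le_trans ler01 m1).
have qA := ler_wpM2r wA drop; have qB := ler_wpM2r wB q16.
have qA1 := ler_wpM2r wA m1; have qB1 := ler_wpM2r wB m1; have qd1 := ler_wpM2r d_ge0 m1.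
have qA16 := ler_wpM2r wA q16; have qd16 := ler_wpM2r d_ge0 q16.
rewrite side_potential_merged; rewrite B512 in hw.
(* With equal homes, [d] is at most [wt A + wt B], and the freed multiples of these weights
   suffice. *)
have [hE|hne] := eqVneq (home A) (home B).
  have dAB : d <= wt A + wt B by apply: same_home_bound.
  have hd : mult M (A `|` B) * d <= mult M (A `|` B) * wt A + mult M (A `|` B) * wt B.
    by rewrite -mulrDr ler_wpM2l // (le_trans ler01 m1).
  rewrite /side_potential; lra.
rewrite (inner_home iB) in hne.
(* Otherwise the home of [A] is on the other side of the border. An inner [Z] there bounds [d]
   together with [A], and the reserve of this border, released now, covers the weight of [Z]. *)
have [LA|LA] := boolP (hasI L (home A)).
  have /has_innerP[Z [ZL iZ lZ]] := LA.
  have ZA : Z != A by apply: contraNneq nA => <-.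
  have hdZ : d <= wt A + wt Z by apply: same_home_bound; rewrite 1?eq_sym // (inner_home iZ).
  have LL : hasI L (lo (A `|` B)) /\ hasI L (lo (A `|` B)).+1.
    by case: lB hA hne LB LA => -> [] ->; rewrite ?eqxx.
  have A256 : mult L A = 256 by rewrite mAU multiplier_noninner // LL.1 LL.2; ring.
  have hZ : wt Z <= 4 * refpair f ctr P (lo (A `|` B)).
    rewrite (inner_weight ctr f_lt (n0 (LCs ZL)) iZ) ler_pM2l //.
    have Zsub : refcost Z <= refcost (piece f P (home A)).
      apply: refcost_sub; apply/fsubsetP => p pZ; rewrite in_piece.
      rewrite (fsubsetP (clustering_sub cCs (LCs ZL)) _ pZ) /= -lZ.
      by rewrite (eqP (allP iZ _ pZ)).
    apply: le_trans Zsub _; rewrite /refpair; case: hA => ->.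
      by rewrite lerDl refcost_ge0.
    by rewrite lerDr refcost_ge0.
  have lK : (lo (A `|` B) < K)%N by apply: lo_lt => //; apply/fsetU_neq0/n0.
  have bd := boundary_drop ctr P live_sub2 lK LL.1 LL.2.
  have {}bd := bd _; rewrite A256 in hw.
  have : ~~ (hasI M (lo (A `|` B)) && hasI M (lo (A `|` B)).+1).
    by case: lB MB => -> /negPf->; rewrite ?andbF.
  move=> /bd; rewrite /side_potential; lra.
(* No inner cluster is left on either side: the union has multiplier 1 and the mate of [B] pays. *)
have MA : ~~ hasI M (home A) by apply: contra LA; apply/has_inner_sub/live_sub2.
have q1 : mult M (A `|` B) = 1.
  rewrite multiplier_noninner //; case: lB hA hne MB MA => -> [] -> //; rewrite ?eqxx //.
    by move=> _ /negPf-> /negPf->.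
  by move=> _ /negPf-> /negPf->.
have [w hdw hmw] := mate_pays iB MB.
rewrite B512 in hmw; rewrite q1 in hU drop *; have := ler_wpM2r wA drop.
rewrite /side_potential; lra.
Qed.

(** Since the union is not inner, [A] and [B] lie on different sides of a border. Either an inner
    cluster remains on one side, or the union has multiplier 1 and the mate of [B] pays. *)
Lemma pay_inner : inner A -> inner B -> side ((A `|` B) |` M) + 9 * d <= side L.
Proof.
move=> iA iB.
have X512 L' X : inner X -> mult L' X = 512 by rewrite /multiplier => ->.
have m2 := merged_multiplier_le.
have mle Y : Y = A \/ Y = B -> mult M (A `|` B) <= mult L Y.
  by case=> ->; rewrite (X512 L) //; lra.
have [MA|MA] := boolP (hasI M (lo A)); first exact: (pay_by_inner (or_introl erefl) iA MA).
have [MB|MB] := boolP (hasI M (lo B)); first exact: (pay_by_inner (or_intror erefl) iB MB).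
have lB := lo_merged (or_intror erefl : B = A \/ B = B).
have lA := lo_merged (or_introl erefl : A = A \/ A = B).
have lAB : lo A != lo B.
  by apply: contra nU => /eqP E; have [] := innerU f_lt (n0 ACs) iA iB E.
have q1 : mult M (A `|` B) = 1.
  rewrite multiplier_noninner //; case: lB lA lAB MB MA => -> [] -> //; rewrite ?eqxx //.
    by move=> _ /negPf-> /negPf->.
  by move=> _ /negPf-> /negPf->.
have [w hdw hmw] := mate_pays iB MB.
have hb := boundary_sub f ctr K P live_sub2.
have ht := total_excess_sub K wt_ge0 lo (inners_sub f K live_sub2).
have wA := wt_ge0 A; have wB := wt_ge0 B; have hU := wt_merged.
rewrite side_potential_merged q1; rewrite !(X512 L) // in hmw.
have d0 := d_ge0; rewrite /side_potential mul1r; lra.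
Qed.

(* Two separated convex clusters cannot both straddle the same border. *)
Lemma merged_inner : convex_in P A -> convex_in P B -> inner A \/ inner B.
Proof.
move=> cA cB; have [iA|nA] := boolP (inner A); first by left.
have [iB|nB] := boolP (inner B); first by right.
have sub X : X = A \/ X = B -> {subset X <= P}.
  by move=> XAB; apply/fsubsetP/(clustering_sub cCs); case: XAB => ->.
have two X : X = A \/ X = B -> ~~ inner X -> exists p q,
    [/\ p \in X, q \in X, f p = lo (A `|` B) & f q = (lo (A `|` B)).+1].
  move=> XAB nX; have X0 : X != fset0 by apply: n0; case: XAB => ->.
  have lX := lo_noninner XAB nX; have [p pX fp] := lo_attained f_lt X0.
  have /allPn[q qX /eqP ne] := nX; exists p, q; split=> //; first by rewrite fp.
  have qU : q \in A `|` B by rewrite in_fsetU; case: XAB qX => -> ->; rewrite ?orbT.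
  move: (lo_le f K qX) (allP merged_narrow _ qU) ne; rewrite /= -lX; clear; lia.
have flt p q : p \in P -> q \in P -> (f p < f q)%N -> p <= q.
  move=> pP qP; rewrite leNgt ltnNge; apply: contra => /ltW; exact: f_mono.
have [a1 [a2 [a1A a2A fa1 fa2]]] := two A (or_introl erefl) nA.
have [b1 [b2 [b1B b2B fb1 fb2]]] := two B (or_intror erefl) nB.
have sA := sub A (or_introl erefl); have sB := sub B (or_intror erefl).
have dis p : p \in A -> p \in B -> False.
  by move=> pA pB; have := fdisjointP (dj ACs BCs AB) _ pA; rewrite pB.
have [h|/ltW h] := leP a1 b1.
  case: (dis b1) => //; apply: (cA a1 a2) => //; first exact: sB.
  by apply: flt; [exact: sB | exact: sA | rewrite fb1 fa2].
case: (dis a1) => //; apply: (cB b1 b2) => //; first exact: sA.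
by apply: flt; [exact: sA | exact: sB | rewrite fa1 fb2].
Qed.

End OnePair.
Lemma fsetD1C (T : choiceType) (S : {fset T}) x y : S `\ x `\ y = S `\ y `\ x.
Proof. by apply/fsetP => z; rewrite !in_fsetD1 andbCA. Qed.

Lemma mergedC A B : merged Cs A B = merged Cs B A.
Proof. by rewrite /merged [A `|` B]fsetUC fsetD1C. Qed.

(** * Preservation of the invariant: the choice between a live and a dead union *)

Section Merge.
Variables A B : {fset R}.
Hypotheses (ACs : A \in Cs) (BCs : B \in Cs) (AB : A != B) (dE : merge_cost A B = d).

Let BA : B != A. Proof. by rewrite eq_sym. Qed.
Let dE' : merge_cost B A = d. Proof. by rewrite merge_costC. Qed.

Lemma live_noninner : A \in L -> B \in L -> mate A B A -> mate A B B ->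
  convex_in P (A `|` B) -> ~~ inner (A `|` B) ->
  exists L', ward_invariant (merged Cs A B) L' b d.
Proof.
move=> AL BL mA mB cU nU.
have sw X : mate A B X -> mate B A X by case=> Y [YL YA YB hY]; exists Y.
have nU' : ~~ inner (B `|` A) by rewrite fsetUC.
have cU' : convex_in P (B `|` A) by rewrite fsetUC.
have nC : narrow (A `|` B) := merged_narrow ACs BCs AL BL mA mB cU.
have pay : side ((A `|` B) |` (L `\ A `\ B)) + 9 * d <= side L.
  have [iA|iB] := merged_inner ACs BCs AB AL BL mA mB cU
    (clustering_convex cCs ACs) (clustering_convex cCs BCs).
    have [iB|nB] := boolP (inner B).
      exact: (pay_inner ACs BCs AB dE AL BL mA mB cU nU iA iB).
    rewrite [A `|` B]fsetUC fsetD1C.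
    exact: (pay_cross BCs ACs BA dE' BL AL (sw _ mB) (sw _ mA) cU' nU' nB iA).
  have [iA|nA] := boolP (inner A).
    exact: (pay_inner ACs BCs AB dE AL BL mA mB cU nU iA iB).
  exact: (pay_cross ACs BCs AB dE AL BL mA mB cU nU nA iB).
have e0 : 0 <= 4 * d by have := d_ge0; lra.
have sp := spread_merged ACs BCs AB dE.
have wU := wt_merged ACs BCs AB dE.
have big X Y : mate X Y X -> X \in L -> (1 < #|` fiber home L (home X)|)%N.
  case=> Z [ZL ZX _ hZ] XL; rewrite (cardfsD1 X) in_fiber XL eqxx ltnS cardfs_gt0.
  by apply/fset0Pn; exists Z; rewrite in_fsetD1 ZX in_fiber ZL hZ eqxx.
have wit X : mate A B X -> exists2 Y, Y \in (A `|` B) |` (L `\ A `\ B) & home Y = home X.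
  by case=> Y [YL YA YB hY]; exists Y; rewrite // in_fset1U in_live2 YA YB YL orbT.
(* Equal homes pass to the union. Distinct ones are the two reference clusters that it may meet, so
   one of them is its home; [A] and [B] exchange roles if it is that of [A]. *)
have homes : home (A `|` B) = home B \/ home (A `|` B) = home A.
  have [E|ne] := eqVneq (home A) (home B).
    right; apply: homeU; rewrite ?n0 //; first exact: dj.
      exact: (inv_narrow I).
    exact: (inv_narrow I).
  have hA := home_merged ACs BCs AB AL BL mA mB cU (or_introl erefl).
  have hB := home_merged ACs BCs AB AL BL mA mB cU (or_intror erefl).
  have hU := home_or f K (A `|` B).
  move: ne hA hB hU; clear; move/eqP; lia.
case: homes => hE.
  exists ((A `|` B) |` (L `\ A `\ B)); apply: (live_step ACs BCs AB e0) => //.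
  - by move=> iU; rewrite iU in nU.
  - exact: wit.
  - by move=> _; apply: big mA AL.
  - lra.
exists ((B `|` A) |` (L `\ B `\ A)); rewrite mergedC.
apply: (live_step BCs ACs BA e0) => //; rewrite ?[B `|` A]fsetUC //.
- by move=> iU; rewrite iU in nU.
- by rewrite fsetD1C; apply: wit.
- by move=> _; apply: (big B A) => //; apply: sw.
- lra.
- rewrite [L `\ B `\ A]fsetD1C; lra.
Qed.

(** Inside one reference cluster weights are additive and spreads vanish, so nothing has to be paid
    and [e = 0] works. *)
Lemma live_inner : A \in L -> B \in L -> inner (A `|` B) ->
  exists L', ward_invariant (merged Cs A B) L' b d.
Proof.
move=> AL BL iU; have A0 := n0 ACs; have B0 := n0 BCs; have U0 := fsetU_neq0 B A0.
have iX X : X != fset0 -> X `<=` A `|` B -> inner X /\ lo X = lo (A `|` B).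
  by move=> X0 /fsubsetP XU; apply: innerP => // p /XU /(allP iU) /eqP.
have [iA lA] := iX A A0 (fsubsetUl _ _); have [iB lB] := iX B B0 (fsubsetUr _ _).
have wU : wt (A `|` B) = wt A + wt B.
  by rewrite !(inner_weight _ f_lt) // refcostU ?mulrDr //; apply: dj.
have UL := merged_notin_live ACs BCs AB.
exists ((A `|` B) |` (L `\ A `\ B)).
apply: (live_step ACs BCs AB (lexx 0)) => //.
- exact: inner_narrow.
- by exists (A `|` B); rewrite ?in_fset1U ?eqxx // !inner_home // lA.
- by rewrite !inner_home.
- by rewrite !inner_home // lA lB eqxx.
- by rewrite wU addr0.
rewrite !(inner_spread f_lt) // mulr0 !addr0 !add0r.
set L' := _ |` _.
have iE : inners L' = (A `|` B) |` (inners L `\ A `\ B).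
  apply/fsetP => X; rewrite !(in_inners, in_fset1U, in_fsetD1).
  by case: eqVneq => [->|_] /=; rewrite ?iU ?andbA.
have hE i : hasI L' i = hasI L i.
  apply/has_innerP/has_innerP => -[X [XL iX' lX]].
    move: XL; rewrite in_fset1U in_live2 => /orP[/eqP E|/and3P[_ _ XL]]; last by exists X.
    by exists A; rewrite lA -E.
  have [E|XA] := eqVneq X A; first by exists (A `|` B); split; rewrite ?in_fset1U ?eqxx // -lA -E.
  have [E|XB] := eqVneq X B; first by exists (A `|` B); split; rewrite ?in_fset1U ?eqxx // -lB -E.
  by exists X; rewrite in_fset1U in_live2 XA XB XL orbT.
have mE X : mult L' X = mult L X by rewrite /multiplier !hE.
have tE : total_excess wt K lo (inners L') <= total_excess wt K lo (inners L).
  have AI : A \in inners L by rewrite in_inners AL.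
  have BI : B \in inners L by rewrite in_inners BL.
  have UI : A `|` B \notin inners L by rewrite in_inners (negPf UL).
  have := @keyed_merge _ _ wt K wt_ge0 lo 0 (inners L) A B (A `|` B) (lexx 0) AI BI AB UI.
  rewrite lA lB lo_lt // wU addr0 lexx eqxx => /(_ isT isT erefl) [] //.
  by rewrite addr0 iE.
have bE : boundary f ctr K P L' = boundary f ctr K P L.
  by apply: eq_bigr => i _; rewrite !hE.
have wE : weighted f ctr K L' = weighted f ctr K L.
  rewrite (weighted_split AB AL BL) /weighted big_fsetU1 ?in_live2 ?(negPf UL) ?andbF //=.
  rewrite mE (eq_bigr (fun X => mult L X * wt X)); last by move=> X _; rewrite mE.
  by rewrite wU /multiplier iU iA iB mulrDr.
by rewrite /side_potential bE wE; lra.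
Qed.

Lemma surplus_lone M X : M `<=` L -> X \in M ->
  (#|` fiber home M (home X)| <= 1)%N -> surplus (M `\ X) = surplus M.
Proof.
move=> ML XM r1; have XL := fsubsetP ML _ XM.
have hK : (home X < K)%N by apply: home_lt => //; [apply/n0/LCs | apply: (inv_narrow I)].
by rewrite (surplusD1 XM hK) ltnNge r1 addn0.
Qed.

(** An inner union is kept live. Any other union dies if one of its parts is dead or has no mate,
    and lives otherwise. *)
Lemma merge_step : convex_in P (A `|` B) ->
  exists L' b', ward_invariant (merged Cs A B) L' b' d.
Proof.
move=> cU.
have dead : ~~ inner (A `|` B) -> paid_drop L (L `\ A `\ B) ->
    exists L' b', ward_invariant (merged Cs A B) L' b' d.
  move=> nU pd; have [b' H] := dead_step ACs BCs AB dE nU pd.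
  by exists (L `\ A `\ B), b'.
have live : (exists L', ward_invariant (merged Cs A B) L' b d) ->
    exists L' b', ward_invariant (merged Cs A B) L' b' d.
  by case=> L' H; exists L', b.
have D1sub X : L `\ X `<=` L by apply: fsubD1set.
have D1out X : X \notin L -> L `\ X = L.
  by move=> XL; apply/fsetP => Y; rewrite in_fsetD1; case: eqVneq => // ->; rewrite (negPf XL).
(* Inner clusters are always live, and a part of an inner union is inner. *)
have not_inner X : X = A \/ X = B -> X \notin L -> ~~ inner (A `|` B).
  move=> XAB; apply: contra => iU.
  have XCs : X \in Cs by case: XAB => ->.
  have XU : {subset X <= A `|` B}.
    by move=> p pX; rewrite in_fsetU; case: XAB pX => -> ->; rewrite ?orbT.
  apply: (inv_inner I XCs); have [] // := @innerP R f K f_lt X (lo (A `|` B)) (n0 XCs).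
  by move=> p /XU /(allP iU) /eqP.
have [AL|AL] := boolP (A \in L); last first.
  apply: dead; first by apply: not_inner AL; left.
  by rewrite D1out //; apply: paid_dropD1.
have [BL|BL] := boolP (B \in L); last first.
  apply: dead; first by apply: not_inner BL; right.
  by rewrite fsetD1C D1out //; apply: paid_dropD1.
have [iU|nU] := boolP (inner (A `|` B)); first exact/live/live_inner.
have ABL : A \in L `\ B by rewrite in_fsetD1 AB.
have BAL : B \in L `\ A by rewrite in_fsetD1 BA.
have sub2 X Y : texcess (L `\ X `\ Y) <= texcess (L `\ Y).
  by rewrite fsetD1C; apply: total_excess_sub => //; apply: fsubD1set.
have [hE|hne] := eqVneq (home A) (home B).
  (* If at most two live clusters share this home, [B] is alone in its fiber once [A] is removed, so
     the surplus drops at most once. *)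
  have [r2|r3] := leqP #|` fiber home L (home A)| 2.
    apply: dead => //.
    have r1 : (#|` fiber home (L `\ A) (home B)| <= 1)%N.
      by rewrite fiberD1 -hE; move: r2; rewrite (cardfsD1 A) in_fiber AL eqxx.
    have sE := surplus_lone (D1sub A) BAL r1.
    case: (paid_dropD1 A (fsubset_refl L)) => [s|[s h]]; [left | right].
      by rewrite sE.
    rewrite sE; split=> //; apply: le_trans h; rewrite lerD2r fsetD1C.
    exact: sub2.
  have [Y YF] : exists Y, Y \in fiber home L (home A) `\ A `\ B.
    apply/fset0Pn; rewrite -cardfs_gt0; move: r3.
    rewrite (cardfsD1 A) in_fiber AL eqxx (cardfsD1 B) in_fsetD1 BA in_fiber BL hE eqxx /=.
    by rewrite !add1n !ltnS.
  move: YF; rewrite !in_fsetD1 in_fiber => /and4P[YB YA YL /eqP hY].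
  by apply/live/live_noninner => //; exists Y; rewrite // -hE.
have [rA|rA] := leqP #|` fiber home L (home A)| 1.
  apply: dead => //; have sE := surplus_lone (fsubset_refl L) AL rA.
  case: (paid_dropD1 B (D1sub A)) => [s|[s h]]; [left | right].
    by rewrite s sE.
  split; first by rewrite -sE.
  by apply: le_trans h _; apply: total_excess_sub.
have [rB|rB] := leqP #|` fiber home L (home B)| 1.
  apply: dead => //; have sE := surplus_lone (fsubset_refl L) BL rB; rewrite fsetD1C.
  case: (paid_dropD1 A (D1sub B)) => [s|[s h]]; [left | right].
    by rewrite s sE.
  split; first by rewrite -sE.
  by apply: le_trans h _; apply: total_excess_sub.
have other X : X \in L -> (1 < #|` fiber home L (home X)|)%N ->
    exists Y, [/\ Y \in L, Y != X & home Y = home X].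
  move=> XL r; have XF : X \in fiber home L (home X) by rewrite in_fiber XL eqxx.
  have [Y YF YX] := card_ge2_other XF r.
  by move: YF; rewrite in_fiber => /andP[YL /eqP hY]; exists Y.
have [Y [YL YA hY]] := other A AL rA; have [Z [ZL ZB hZ]] := other B BL rB.
apply/live/live_noninner => //.
  by exists Y; split => //; apply: contraNneq hne => YB; rewrite -hY YB.
by exists Z; split => //; apply: contraNneq hne => ZA; rewrite -hZ ZA.
Qed.

End Merge.
End OneStep.
End Step.

(** * From the invariant along a run to the cost bound *)

Lemma sum_clustering (R : realType) (P : {fset R}) (Cs : {fset {fset R}})
  (F : R -> R) : clustering P Cs -> \sum_(X <- Cs) \sum_(p <- X) F p = \sum_(p <- P) F p.
Proof.
move=> cCs; rewrite -big_trivIfset; last first.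
  by apply/trivIfsetP => X Y; apply: (clustering_disj cCs).
apply: eq_fbigl => p; apply/bigfcupP/idP => [[X /andP[XCs _] pX]|pP].
  exact: (fsubsetP (clustering_sub cCs XCs)).
by have [X XCs pX] := clustering_cover cCs pP; exists X; rewrite ?XCs.
Qed.

Section Run.
Variables (R : realType) (f : R -> nat) (ctr : nat -> R) (K : nat) (P : {fset R}).
Hypothesis f_lt : forall p, (f p < K)%N.
Hypothesis f_mono : {in P &, forall p q, p <= q -> (f p <= f q)%N}.
Hypothesis f_onto : forall i, (i < K)%N -> exists2 p, p \in P & f p = i.
Implicit Types (Cs L : {fset {fset R}}).

Local Notation wt := (weight f ctr K).

Let wt_ge0 X : 0 <= wt X := weight_ge0 ctr f_lt X.

(** As at least [K] clusters remain, [inv_card] bounds [b] by the surplus, and the home excess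
    absorbs [b * d]. The spread is then at most 11000 times the reference cost, which is added once
    more for the cost inside the pieces. *)
Lemma invariant_cost Cs L b d : clustering P Cs -> 0 <= d ->
  (forall X Y, X \in Cs -> Y \in Cs -> X != Y -> d <= merge_cost X Y) ->
  ward_invariant f ctr K P Cs L b d -> (K <= #|` Cs|)%N ->
  clustering_cost Cs <= 11001 * refcost f ctr P.
Proof.
move=> cCs d0 d_le I KC.
have cost : clustering_cost Cs <= total_spread f K Cs + refcost f ctr P.
  rewrite /refcost -(sum_clustering _ cCs) /total_spread -big_split /=.
  by apply: ler_sum => X _; apply: Delta_le_spread.
have hb : (b <= surplus K (home f K) L)%N by move: (inv_card I) KC; clear; lia.
have := surplus_card K wt_ge0 d0 (fun i => fiber_home_bound f_lt cCs I d_le (i := i) (fsubset_refl L)).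
have : b%:R * d <= (surplus K (home f K) L)%:R * d by rewrite ler_wpM2r // ler_nat.
have sd : 0 <= side_potential f ctr K P L.
  rewrite /side_potential addr_ge0 // ?addr_ge0 // ?mulr_ge0 //.
  - exact: total_excess_ge0.
  - apply: sumr_ge0 => X _; rewrite mulr_ge0 //.
    by apply: le_trans (multiplier_ge1 f K L X).
  - by apply: sumr_ge0 => i _; case: ifP => // _; apply: refpair_ge0.
have := inv_energy I; rewrite /potential; lra.
Qed.

Lemma inner_singleton p : inner f K [fset p].
Proof.
apply: (innerP f_lt (i := f p) _ _).1; first by apply/fset0Pn; exists p; rewrite inE.
by move=> q; rewrite inE => /eqP->.
Qed.

Lemma excess_le_wsum (S : {fset {fset R}}) : excess wt S <= wsum wt S.
Proof.
apply: excess_le => [|A _]; first exact: wsum_ge0.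
by rewrite lerBlDr lerDl.
Qed.

Lemma total_excess_le (key : {fset R} -> nat) L :
  (forall X, X \in L -> (key X < K)%N) -> total_excess wt K key L <= wsum wt L.
Proof.
by move=> kL; rewrite /wsum (sum_fibers _ kL); apply: ler_sum => i _; apply: excess_le_wsum.
Qed.

(** Each reference cluster belongs to at most two consecutive pairs. *)
Lemma boundary_le L : boundary f ctr K P L <= 2 * refcost f ctr P.
Proof.
have e1 : refcost f ctr P = \sum_(i < K) refcost f ctr (piece f P i).
  by rewrite {1}/refcost (sum_pieces f_lt).
have e2 : \sum_(i < K) refcost f ctr (piece f P i.+1) <= refcost f ctr P.
  have : \sum_(i < K.+1) refcost f ctr (piece f P i) = refcost f ctr P.
    rewrite big_ord_recr /= -e1 [X in _ + X](_ : _ = 0) ?addr0 //.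
    (* The shifted sum reaches index [K], which [f] never takes. *)
    have -> : piece f P K = fset0.
      by apply/fsetP => p; rewrite in_piece ltn_eqF ?andbF ?f_lt.
    exact: big_seq_fset0.
  by rewrite big_ord_recl => <-; rewrite lerDr refcost_ge0.
apply: le_trans (_ : \sum_(i < K) refpair f ctr P i <= _).
  by apply: ler_sum => i _; case: ifP => // _; apply: refpair_ge0.
by rewrite /refpair big_split /= -e1; lra.
Qed.

(** All singletons are inner, of total weight [4 W] with [W] the reference cost of [P]. The
    potential is at most [(2 * 4 + 2066 * 4 + 512 * 4 + 292 * 2) W = 10904 W], whence the constant
    11000. *)
Lemma invariant_singletons :
  ward_invariant f ctr K P (singletons P) (singletons P) 0 0.
Proof.
have cS := clustering_singletons P.
have iS X : X \in singletons P -> inner f K X.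
  by case/imfsetP => p /= _ ->; apply: inner_singleton.
have nS X : X \in singletons P -> X != fset0 := @clustering_neq0 _ P _ cS X.
have homeK X : X \in singletons P -> (home f K X < K)%N.
  by move=> XS; apply: home_lt; rewrite ?nS // inner_narrow // iS.
have loK X : X \in inners f K (singletons P) -> (lo f K X < K)%N.
  by rewrite in_inners => /andP[XS _]; apply: lo_lt; rewrite // nS.
split=> //.
- by move=> X /iS /inner_narrow.
- move=> i /f_onto[p pP <-]; left; exists [fset p].
    by apply/imfsetP; exists p.
  have [ip lp] : inner f K [fset p] /\ lo f K [fset p] = f p.
    by apply: innerP => [//||q]; [apply/fset0Pn; exists p | ]; rewrite inE // => /eqP->.
  by rewrite inner_home.
- rewrite addn0 -[X in (X <= _)%N](count_predT (singletons P)) -sum1_count.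
  rewrite (sum_fibers (V := nat) _ homeK) /surplus -[X in (X + _)%N]card_ord -sum1_card.
  rewrite -big_split /=; apply: leq_sum => i _.
  by rewrite sum1_count count_predT add1n leqSpred.
have wE : wsum wt (singletons P) = 4 * refcost f ctr P.
  rewrite /refcost -(sum_clustering _ cS) mulr_sumr /wsum big_seq [RHS]big_seq.
  by apply: eq_bigr => X XS; rewrite (inner_weight _ f_lt) ?nS ?iS.
have sE : total_spread f K (singletons P) = 0.
  rewrite /total_spread big_seq big1 // => X XS.
  by rewrite (inner_spread f_lt) ?nS ?iS.
have iE : inners f K (singletons P) = singletons P.
  by apply/fsetP => X; rewrite in_inners; case XS: (X \in _) => //=; apply: iS.
have hE : weighted f ctr K (singletons P) = 512 * wsum wt (singletons P).
  rewrite /weighted /wsum mulr_sumr big_seq [RHS]big_seq.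
  by apply: eq_bigr => X XS; rewrite /multiplier iS.
have t1 := total_excess_le homeK; have t2 := total_excess_le loK.
have bL := boundary_le (singletons P); have W0 := refcost_ge0 f ctr P.
rewrite iE in t2; rewrite /potential /side_potential iE sE hE; lra.
Qed.

Lemma ward_run_invariant n Cs : ward_run P n Cs ->
  [/\ clustering P Cs, #|` P| = (#|` Cs| + n)%N &
    exists L b d, [/\ 0 <= d,
      forall X Y, X \in Cs -> Y \in Cs -> X != Y -> d <= merge_cost X Y &
      ward_invariant f ctr K P Cs L b d]].
Proof.
elim: n Cs => [|n IH] Cs /=.
  move=> ->; have cS := clustering_singletons P; split=> //.
    by rewrite addn0 card_imfset //= => p q /fset1_inj.
  exists (singletons P), 0%N, 0; split=> //; last exact: invariant_singletons.
  by move=> X Y XS YS XY; apply: merge_cost_ge0; apply: (clustering_disj cS).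
case=> Cs0 [/IH[cCs cardP [L [b [d [d0 d_le I]]]]] [A [B [ACs BCs AB min ->]]]].
have dle := d_le _ _ ACs BCs AB; have d0' := le_trans d0 dle.
(* Merge costs never decrease, so the charge [b * d] may be restated with the cost of the present
   merge. *)
have I' : ward_invariant f ctr K P Cs0 L b (merge_cost A B).
  case: I => h1 h2 h3 h4 h5 h6; split=> //; apply: le_trans h6 _.
  by rewrite lerD2l ler_wpM2l.
split; first exact: (clustering_merge cCs ACs BCs AB min).
  by rewrite cardP (card_merge cCs ACs BCs AB) addSnnS.
have [L' [b' H]] := merge_step f_lt f_mono cCs I' d0' min ACs BCs AB erefl
  (merged_convex cCs ACs BCs AB min).
exists L', b', (merge_cost A B); split=> //.
exact: least_pair_merge cCs ACs BCs AB min.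
Qed.

End Run.

(** * Reference clusters of a set of centers on the line *)

(** Adding the two hypotheses on squares gives [(q - p) * (c - e) <= 0]. *)
Lemma nearest_center_monotone (R : realFieldType) (p q c e : R) :
  p < q -> (p - c) ^+ 2 <= (p - e) ^+ 2 -> (q - e) ^+ 2 <= (q - c) ^+ 2 -> c <= e.
Proof.
move=> pq h1 h2; rewrite leNgt; apply/negP => ec.
have : 0 < (q - p) * (c - e) by rewrite mulr_gt0 // subr_gt0.
nra.
Qed.

(** Only centers chosen by some point of [P] are kept, in increasing order, so that no reference
    cluster is empty; hence [K] may be less than the number of centers. *)
Lemma indexed_centers (R : realType) (P C : {fset R}) :
  P != fset0 -> (0 < #|` C|)%N ->
  exists (f : R -> nat) (ctr : nat -> R) (K : nat),
    [/\ (K <= #|` C|)%N, forall p, (f p < K)%N,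
        {in P &, forall p q, p <= q -> (f p <= f q)%N},
        forall i, (i < K)%N -> exists2 p, p \in P & f p = i
      & refcost f ctr P = center_cost P C].
Proof.
move=> P0 C0.
have /choice[h hP] : forall p : R, exists c, c \in C /\ sqdist p C = (p - c) ^+ 2.
  by move=> p; have [c ? ?] := sqdist_witness p C0; exists c.
pose U := [fset h p | p in P]; pose s := sort <=%R (enum_fset U).
have memU p : p \in P -> h p \in s.
  by move=> pP; rewrite mem_sort; apply/imfsetP; exists p.
have us : uniq s by rewrite sort_uniq fset_uniq.
have ss : sorted <=%R s by apply: sort_sorted; apply: le_total.
have sz : size s = #|` U| by rewrite size_sort.
have U0 : (0 < #|` U|)%N.
  by case/fset0Pn: P0 => p pP; rewrite cardfs_gt0; apply/fset0Pn; exists (h p); apply/imfsetP; exists p.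
(* The value 0 outside [P] is a dummy that keeps [f p < K] for every real [p]. *)
exists (fun p => if p \in P then index (h p) s else 0%N), (nth 0 s), (size s); split.
- rewrite sz; apply: fsubset_leq_card; apply/fsubsetP => _ /imfsetP[p /= _ ->].
  by have [] := hP p.
- by move=> p; case: ifP => [/memU|_]; rewrite ?index_mem // sz.
- move=> p q pP qP; rewrite pP qP le_eqVlt => /orP[/eqP->//|pq].
  have hpq : h p <= h q.
    have [pC pE] := hP p; have [qC qE] := hP q.
    apply: (nearest_center_monotone pq); first by rewrite -pE; apply: sqdist_le.
    by rewrite -qE; apply: sqdist_le.
  rewrite leqNgt; apply/negP => lt.
  (* A smaller index gives the reverse order of the centers, hence equal centers and equal
     indices. *)
  have hqp : h p >= h q := sorted_ltn_index le_trans ss _ _ (memU _ qP) (memU _ pP) lt.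
  by move: lt; rewrite (@le_anti _ _ (h p) (h q)) ?ltnn // hpq.
- move=> i si; have : nth 0 s i \in s by apply: mem_nth.
  rewrite mem_sort => /imfsetP[p /= pP E]; exists p => //.
  by rewrite pP -E index_uniq.
- rewrite /refcost /center_cost big_seq [RHS]big_seq; apply: eq_bigr => p pP.
  by have [_ ->] := hP p; rewrite pP nth_index // memU.
Qed.

Theorem theorem24 (R : realType) :
  exists c : R, 0 < c /\
    forall (P : {fset R}) (k : nat) (Cs : {fset {fset R}}),
      (1 <= k)%N -> (k <= #|` P|%fset)%N ->
      ward_clustering k P Cs ->
      clustering_cost Cs <= c * opt k P.
Proof.
exists 11001; split=> // P k Cs k1 kP run.
have [C [Ck -> _]] := opt_attained k1 kP.
have P0 : P != fset0 by rewrite -cardfs_gt0 (leq_trans k1).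
have C0 : (0 < #|` C|)%N by rewrite Ck.
have [f [ctr [K [KC f_lt f_mono f_onto <-]]]] := indexed_centers P0 C0.
have [cCs cardP [L [b [d [d0 d_le I]]]]] := ward_run_invariant ctr f_lt f_mono f_onto run.
(* Here [K] is at most [k], the number of clusters left after the merges. *)
apply: (invariant_cost f_lt cCs d0 d_le I); rewrite (leq_trans KC) // Ck.
by move: cardP kP; clear; lia.
Qed.
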